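(* Let $u_n=\operatorname{arg\,max}_{k\in\mathbb{N}_0}\mathbb{L}_n(k)$ be the mode of the external profile of a binary search tree with $n+1$ external nodes. There is an a.s. finite random variable $K$ such that for all $n>K$, the mode $u_n$ is equal to one of the numbers $$\lfloor2\log n+\chi_1(0)-1/2\rfloor\quad\text{or}\quad\lceil2\log n+\chi_1(0)-1/2\rceil .$$ (If the arg max is not unique, this means: for $n>K$ there are at most two maximizers of $k\mapsto\mathbb{L}_n(k)$ and they all belong to this two-element set.)
   Context: Binary search tree (BST) process: at time $n=0$ there is one external node, the root, at depth $0$. At each step one of the existing external nodes is picked uniformly at random (independently of the past given the current tree), declared internal, and connected to two new external nodes, each of depth one larger than that of the picked node. After $n$ steps the tree has $n$ internal and $n+1$ external nodes; the trees for all $n$ are defined on one probability space through this evolution. The depth of a node is its distance to the root. $\mathbb{L}_n(k)$ is the number of external nodes at depth $k$ after $n$ steps; $x_{1,n},\dots,x_{n+1,n}$ are the depths of the external nodes. Let $\beta_-\approx-1.678$ and $\beta_+\approx0.768$ be the solutions of $2e^\beta(1-\beta)=1$, and let $W_n(\beta)=n^{-(2e^\beta-1)}\sum_{i=1}^{n+1}e^{\beta x_{i,n}}$, $\beta\in\mathbb{C}$. There are an open set $\mathscr{D}\subset\mathbb{C}$ containing $(\beta_-,\beta_+)$ and a random analytic function $W_\infty$ on $\mathscr{D}$ such that, almost surely, $W_n\to W_\infty$ uniformly on compact subsets of $\mathscr{D}$; one has $W_\infty(0)=1$. Put $\chi_1(0)=(\log W_\infty)'(0)=W_\infty'(0)$;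 it is also the a.s. limit of $\frac1{n+1}\sum_{i=1}^{n+1}x_{i,n}-2\log n$ as $n\to\infty$. $\lfloor\cdot\rfloor,\lceil\cdot\rceil$ are the floor and ceiling functions. *)

(* Defs.v *)
From HB Require Import structures.
From mathcomp Require Import all_boot all_order all_algebra.
From mathcomp Require Import all_classical all_reals all_analysis.
From mathcomp Require Import measurable_realfun lebesgue_measure complex.

Set Implicit Arguments.
Unset Strict Implicit.
Unset Printing Implicit Defensive.

Import Order.TTheory GRing.Theory Num.Theory numFieldNormedType.Exports.

Local Open Scope classical_set_scope.
Local Open Scope ring_scope.
Local Open Scope complex_scope.

Inductive bst : Type := External | Internal of bst & bst.

(* A node is addressed by the path from the root to it: false stands for the
   left child, true for the right child. *)
Definition node := seq bool.
Definition depth (v : node) : nat := size v.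

Fixpoint external_nodes (t : bst) : seq node :=
  match t with
  | External => [:: [::]]
  | Internal l r => [seq false :: v | v <- external_nodes l] ++
                    [seq true :: v | v <- external_nodes r]
  end.

(* Declares the external node v internal and connects it to two new external
   nodes; t is unchanged when v is not an external node of t. *)
Fixpoint grow (t : bst) (v : node) : bst :=
  match t, v with
  | External, [::] => Internal External External
  | Internal l r, false :: v' => Internal (grow l v') r
  | Internal l r, true :: v' => Internal l (grow r v')
  | _, _ => t
  end.

(* The tree after n steps when the node picked at step k.+1 is h k. *)
Fixpoint grow_seq (h : nat -> node) (n : nat) : bst :=
  if n is m.+1 then grow (grow_seq h m) (h m) else External.

Section BSTProcess.
Context (R : realType) (d : measure_display) (T : measurableType d).
Implicit Type pick : nat -> T -> node.

Definition bst_tree pick (n : nat) (w : T) : bst := grow_seq (pick ^~ w) n.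

(* pick n w is the external node of the n-th tree picked at step n.+1.  The
   picks h 0, ..., h n.-1 determine all the trees up to time n, so the last
   field says that, conditionally on the past, the next pick is uniform on
   the external nodes of the current tree. *)
Record bst_process (P : probability T R) pick : Prop := BSTProcess {
  pick_measurable : forall n v, measurable [set w | pick n w = v];
  pick_external : forall n w, pick n w \in external_nodes (bst_tree pick n w);
  pick_uniform : forall (n : nat) (h : nat -> node) (v : node),
    v \in external_nodes (grow_seq h n) ->
    (P ([set w | forall k, (k < n)%N -> pick k w = h k] `&`
        [set w | pick n w = v]) =
     P [set w | forall k, (k < n)%N -> pick k w = h k] *
       ((size (external_nodes (grow_seq h n)))%:R^-1)%:E)%E }.

Definition profile pick (n : nat) (w : T) (k : nat) : nat :=
  count (fun v => depth v == k) (external_nodes (bst_tree pick n w)).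

Definition modes pick (n : nat) (w : T) : set nat :=
  [set k | forall j, (profile pick n w j <= profile pick n w k)%N].

Definition cexp (z : R[i]) : R[i] :=
  (expR (complex.Re z) * cos (complex.Im z)) +i*
  (expR (complex.Re z) * sin (complex.Im z)).

(* The complex power n ^ s is exp (s log n). *)
Definition biggins pick (n : nat) (w : T) (b : R[i]^o) : R[i]^o :=
  cexp (- (2 * cexp b - 1) * (ln n%:R)%:C) *
  \sum_(v <- external_nodes (bst_tree pick n w)) cexp (b * (depth v)%:R).

(* R[i]^o carries the usual topology of the complex plane, and derivable, at
   this type, is complex differentiability. *)
Record biggins_limit (P : probability T R) pick (bm bp : R)
    (D : set R[i]^o) (W : T -> R[i]^o -> R[i]^o) : Prop := BigginsLimit {
  limit_open : open D;
  limit_interval : forall b : R, bm < b -> b < bp -> D b%:C;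
  limit_measurable : forall b, D b ->
    measurable_fun [set: T] (fun w => complex.Re (W w b)) /\
    measurable_fun [set: T] (fun w => complex.Im (W w b));
  limit_analytic : {ae P, forall w, forall b, D b -> derivable (W w) b 1};
  limit_uniform : {ae P, forall w, forall A : set R[i]^o,
    compact A -> A `<=` D ->
    {uniform A, (fun n => biggins pick n w) @ \oo --> W w}} }.

(* W'(0) is almost surely real, since W is real on the real axis. *)
Definition chi1 (W : T -> R[i]^o -> R[i]^o) (w : T) : R :=
  complex.Re (derive1 (W w) 0).

End BSTProcess.

(* Main.v *)
Require Import Defs.
From HB Require Import structures.
From mathcomp Require Import all_boot all_order all_algebra.
From mathcomp Require Import all_classical all_reals all_analysis.
From mathcomp Require Import measurable_realfun lebesgue_measure complex.
From mathcomp Require Import ring lra zify.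

Import Order.TTheory GRing.Theory Num.Theory numFieldNormedType.Exports.

Local Open Scope classical_set_scope.
Local Open Scope ring_scope.

(** Fix an early time [m]. Given the tree at time [m], a uniformly chosen external
    node at time [n] has a uniformly chosen ancestor among the external nodes at
    time [m], and the number of levels between them is an independent sum of
    Bernoulli variables of parameters [2 / (l + 2)], [m <= l < n]. So the
    conditional mean of the profile is [n + 1] times an average of translates of
    the law of that sum ([growth_mean_prof]). This law is within [12 / (m + 1)]
    of a Poisson law ([kernel_poi]), whose mean [s] is close to
    [2 ln n - 2 ln m] ([hop_sum_ln]).

    Averaging translates of a Poisson law by the early depths amounts, to first
    order, to a shift by their average [a_m] ([nab_smear_poi]): the averaged
    weights increase up to [s + a_m] and decrease afterwards, with differences
    of order [s ^ (-3/2)] per unit of distance to [s + a_m]. The integers at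
    which such a function may be maximal fill an interval of length one centred
    at [s + a_m - 1/2], and an error smaller than [s ^ (-3/2)] moves them very
    little: every maximiser is at distance less than one from any point close to
    [s + a_m - 1/2] ([mode_close]), so it is the floor or the ceiling of that
    point.

    Now [s + a_m] is close to [2 ln n + (a_m - 2 ln m)], and [a_m - 2 ln m] is
    [W_m'(0)] up to a vanishing error. These derivatives converge to
    [chi_1(0) = W_oo'(0)] ([biggins_deriv_cvg]): the functions [W_m] are uniform
    limits of polynomials on a disc, and averaging a polynomial over equidistant
    points of a circle extracts its coefficient of degree one. The error terms of
    the first order expansion involve the mean squared depth at time [m], which
    is [O((ln m) ^ 2)] because [W_m(b)] stays bounded for some real [b > 0]
    ([mean_sqr_le]).

    The fluctuations of the profile around its conditional mean have second
    moments, summed over all levels, of at most [10 (n + 1) ^ 2 / (m + 1)]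
    ([growth_variance_le]), because the conditional means form a martingale. For
    [2 ^ i <= n < 2 ^ (i + 1)] take [m = i ^ 8] and allow a deviation of
    [i ^ (-2)] times [n + 1], which is well below [s ^ (-3/2)] since [s] has
    order [i]. By Markov's inequality the exceptional probability is at most
    [10 i ^ (-4)], which remains summable when each dyadic block is tested at
    [i ^ 2] equidistant times ([bad_prob]); in between, a step changes the
    profile at any level by at most two. The Borel-Cantelli lemma
    ([bad_io_null]) gives the localisation of the modes at all large times
    ([modes_eventually]). The random variable [K] is the last exceptional time
    ([last_time_exists]); it is measurable because [chi_1(0)] is a limit of
    functions of finite trees. *)

(** * Poisson weights and their differences *)

Section Poisson.
Set Implicit Arguments. Unset Strict Implicit.
Context {R : realType}.
Implicit Types (f g : nat -> R) (s t x : R) (i k n : nat).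

Definition poi s k : R := expR (- s) * (s ^+ k / k`!%:R).

Definition delay f k : R := if k is i.+1 then f i else 0.

Definition nab f k : R := f k - delay f k.

Definition conv f g k : R := \sum_(i < k.+1) f i * g (k - i)%N.

Lemma poi_ge0 s k : 0 <= s -> 0 <= poi s k.
Proof.
by move=> s0; rewrite /poi mulr_ge0 ?expR_ge0// divr_ge0 ?exprn_ge0 ?ler0n.
Qed.

Lemma poi_mean0 k : poi 0 k = (k == 0%N)%:R.
Proof.
rewrite /poi oppr0 expR0 mul1r expr0n.
by case: k => [|k]/=; rewrite ?fact0 ?divr1 ?mul0r.
Qed.

Lemma convC f g : conv f g = conv g f.
Proof.
apply/funext => k; rewrite /conv (reindex_inj rev_ord_inj)/=.
apply: eq_bigr => i _; rewrite mulrC subSS subKn//; exact: leq_ord.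
Qed.

Lemma conv_delayl f g : conv (delay f) g = delay (conv f g).
Proof.
apply/funext => -[|k]; rewrite /conv ?big_ord1/= ?mul0r//.
by rewrite big_ord_recl/= mul0r add0r; apply: eq_bigr => i _.
Qed.

Lemma conv_nabl f g : conv (nab f) g = nab (conv f g).
Proof.
apply/funext => k; rewrite /(nab (conv _ _)) -conv_delayl /conv -sumrB.
by apply: eq_bigr => i _; rewrite /nab mulrBl.
Qed.

Lemma conv_nabr f g : conv f (nab g) = nab (conv f g).
Proof. by rewrite convC conv_nabl convC. Qed.

Lemma conv_poi s t : conv (poi s) (poi t) = poi (s + t).
Proof.
apply/funext => k; rewrite /conv /poi opprD expRD exprDn.
rewrite mulr_suml mulr_sumr (reindex_inj rev_ord_inj)/=.
apply: eq_bigr => i _; have ik : (i <= k)%N := leq_ord i.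
rewrite subSS subKn//.
have /(congr1 (fun n => n%:R : R)) := bin_fact ik; rewrite !natrM => <-.
have f0 n : (n`!%:R : R) != 0 by rewrite pnatr_eq0 -lt0n fact_gt0.
have b0 : ('C(k, i)%:R : R) != 0 by rewrite pnatr_eq0 -lt0n bin_gt0.
rewrite -mulr_natr.
by field; rewrite !f0 b0.
Qed.

(** The endpoint case of Young's inequality; bounds on partial sums stand for
    the [l^1] norm, which spares summability hypotheses. *)
Lemma norm_conv f g (A B : R) k : 0 <= B ->
  (forall i, \sum_(j < i) `|f j| <= A) -> (forall i, `|g i| <= B) ->
  `|conv f g k| <= A * B.
Proof.
move=> B0 fA gB; rewrite /conv (le_trans (ler_norm_sum _ _ _))//.
apply: (@le_trans _ _ (\sum_(i < k.+1) `|f i| * B)).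
  by apply: ler_sum => i _; rewrite normrM ler_wpM2l.
by rewrite -mulr_suml ler_wpM2r.
Qed.

Lemma poi_mass_le1 s n : 0 <= s -> \sum_(i < n) poi s i <= 1.
Proof.
move=> s0; rewrite /poi -mulr_sumr expRN mulrC ler_pdivrMr ?expR_gt0// mul1r.
have := @nondecreasing_cvgn_le _ (series (exp_coeff s)) _ _ n.
rewrite /series/= big_mkord; apply; last exact: is_cvg_series_exp_coeff.
by apply: nondecreasing_series => i _ _; exact: exp_coeff_ge0.
Qed.

Lemma poi_mass_cvg s : series (poi s) @ \oo --> (1 : R).
Proof.
have -> : series (poi s) = (fun n => expR (- s) * series (exp_coeff s) n).
  by apply/funext => n; rewrite /series/= mulr_sumr.
rewrite -(expRxMexpNx_1 s) mulrC.
apply: cvgMr; exact: is_cvg_series_exp_coeff.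
Qed.

Lemma poiS s k : poi s k.+1 = poi s k * s / k.+1%:R.
Proof.
have f0 n : (n`!%:R : R) != 0 by rewrite pnatr_eq0 -lt0n fact_gt0.
rewrite /poi factS natrM exprS; field.
by rewrite f0 andbT (_ : 1 + k%:R = k.+1%:R) ?pnatr_eq0// -natr1 addrC.
Qed.

Lemma poiSE s k : poi s k.+1 * k.+1%:R = poi s k * s.
Proof. by rewrite poiS mulfVK// pnatr_eq0. Qed.

Lemma nab_poi s k : 0 < s -> nab (poi s) k = poi s k * (s - k%:R) / s.
Proof.
move=> s0; case: k => [|k]; rewrite /nab/=.
  by rewrite !subr0 mulfK// gt_eqF.
rewrite mulrBr poiSE mulrBl !mulfK// gt_eqF//.
Qed.

(** The defect between [s] times the mass and a partial variance telescopes to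
    a single difference of two weights, whose sign is known past [s]; so the
    partial variances are bounded without any convergence argument. *)
Lemma poi_var_exact s n :
  \sum_(i < n.+2) poi s i * (i%:R - s) ^+ 2 =
  s * (\sum_(i < n.+1) poi s i) + s ^+ 2 * (poi s n.+1 - poi s n).
Proof.
elim: n => [|n IH].
  rewrite !big_ord_recl !big_ord0/= /bump/= poiS invr1.
  by ring.
rewrite big_ord_recr/= IH [in RHS]big_ord_recr/=.
have h1 := poiSE s n; have h2 := poiSE s n.+1.
have e1 : n.+1%:R = n%:R + 1 :> R by rewrite natr1.
have e2 : n.+2%:R = n%:R + 2 :> R by rewrite -addn2 natrD.
rewrite e1 in h1; rewrite e2 in h2 *.
set a := poi s n.+2 in h2 *; set b := poi s n.+1 in h1 h2 *.
set c := poi s n in h1 *; set S := \sum_(i < _) _.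
have -> : s * S + s ^+ 2 * (b - c) + a * (n%:R + 2 - s) ^+ 2 =
    s * S + s ^+ 2 * b - s * (c * s) + (a * (n%:R + 2) * (n%:R + 2 - s)
    - s * (a * (n%:R + 2)) + s ^+ 2 * a) by ring.
rewrite h2 -h1; ring.
Qed.

Lemma poi_var_le s n : 0 < s ->
  \sum_(i < n) poi s i * (i%:R - s) ^+ 2 <= s.
Proof.
move=> s0; pose N := maxn n (Num.bound s).+2.
have nN : (n <= N)%N by rewrite leq_maxl.
apply: (@le_trans _ _ (\sum_(i < N) poi s i * (i%:R - s) ^+ 2)).
  rewrite -!(big_mkord xpredT (fun i => poi s i * (i%:R - s) ^+ 2)).
  rewrite (big_cat_nat (leq0n n) nN)//= lerDl sumr_ge0// => i _.
  by rewrite mulr_ge0 ?sqr_ge0 ?poi_ge0// ltW.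
have : ((Num.bound s).+2 <= N)%N by rewrite leq_maxr.
case: N nN => [//|[//|N]] _; rewrite !ltnS => sN.
have {}sN : s <= N%:R.
  by rewrite (le_trans (ltW (archi_boundP (ltW s0))))// ler_nat.
rewrite poi_var_exact -[leRHS]addr0 lerD//.
  by rewrite ger_pMr// poi_mass_le1 ?ltW.
rewrite mulr_ge0_le0 ?sqr_ge0// subr_le0 poiS ler_pdivrMr ?ltr0n//.
rewrite ler_wpM2l ?poi_ge0 ?ltW//= (le_lt_trans sN)// ltr_nat//.
Qed.

(** The weights [poi s i * |s - i| / s] sum to a mean absolute deviation over
    [s], at most the standard deviation over [s]. *)
Lemma nab_poi_l1 s n : 0 < s ->
  \sum_(i < n) `|nab (poi s) i| <= (Num.sqrt s)^-1.
Proof.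
move=> s0; set y := Num.sqrt s.
have y0 : 0 < y by rewrite sqrtr_gt0.
have ys : y ^+ 2 = s by rewrite sqr_sqrtr// ltW.
have yn0 : y != 0 by rewrite gt_eqF.
apply: (@le_trans _ _
  (\sum_(i < n) (poi s i * (i%:R - s) ^+ 2 / y + poi s i * y) / (2 * s))).
  apply: ler_sum => i _; have p0 : 0 <= poi s i by rewrite poi_ge0 ?ltW.
  rewrite nab_poi// (normrM _ s^-1) (normrM (poi s i)) (ger0_norm p0).
  rewrite (gtr0_norm (x := s^-1)) ?invr_gt0//.
  have -> : (poi s i * (i%:R - s) ^+ 2 / y + poi s i * y) / (2 * s) =
      poi s i * ((i%:R - s) ^+ 2 / y + y) / (2 * s) by field; rewrite yn0; lra.
  rewrite distrC -[in leRHS]real_normK ?num_real//.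
  set d := `|_|.
  have -> : poi s i * (d ^+ 2 / y + y) / (2 * s) =
     poi s i * d / s + poi s i * (d - y) ^+ 2 / (2 * s * y).
    by field; rewrite yn0; lra.
  by rewrite lerDl divr_ge0// (mulr_ge0 p0 (sqr_ge0 _), mulr_ge0)// ltW// mulr_gt0.
rewrite -mulr_suml big_split/= -!mulr_suml.
have h1 := poi_var_le n s0; have h2 := poi_mass_le1 n (ltW s0).
rewrite ler_pdivrMr ?mulr_gt0//.
apply: (@le_trans _ _ (s / y + 1 * y)).
  by rewrite lerD// ler_wpM2r ?invr_ge0 ?(ltW y0).
rewrite -ys le_eqVlt; apply/orP; left; apply/eqP; by field.
Qed.

Lemma sum_nab f k : f k = \sum_(i < k.+1) nab f i.
Proof.
elim: k => [|k IH]; first by rewrite big_ord1 /nab/= subr0.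
by rewrite big_ord_recr/= -IH /nab/= addrC subrK.
Qed.

Lemma poi_le s k : 0 < s -> `|poi s k| <= (Num.sqrt s)^-1.
Proof.
move=> s0; rewrite sum_nab (le_trans (ler_norm_sum _ _ _))//.
exact: nab_poi_l1.
Qed.

(** A Poisson law is the convolution of two halves: the difference goes on one
    of them, at the cost of its total variation, and the supremum is taken on
    the other. *)
Lemma nab_poi_le s k : 0 < s -> `|nab (poi s) k| <= 2 / s.
Proof.
move=> s0; have h0 : 0 < s / 2 by rewrite divr_gt0.
have -> : poi s = conv (poi (s / 2)) (poi (s / 2)).
  by rewrite conv_poi -splitr.
have -> : 2 / s = (Num.sqrt (s / 2))^-1 * (Num.sqrt (s / 2))^-1.
  by rewrite -invfM -expr2 sqr_sqrtr ?(ltW h0)// invf_div.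
rewrite -conv_nabl; apply: norm_conv => [|i|i]; first by rewrite invr_ge0 sqrtr_ge0.
  exact: nab_poi_l1.
exact: poi_le.
Qed.

(** As for [nab_poi_le], with four quarters: one difference on each of three
    factors, the supremum on the fourth. *)
Lemma nab3_poi_le s k : 0 < s -> `|nab (nab (nab (poi s))) k| <= 16 / s ^+ 2.
Proof.
move=> s0; have h0 : 0 < s / 4 by rewrite divr_gt0.
have -> : poi s = conv (poi (s / 4))
    (conv (poi (s / 4)) (conv (poi (s / 4)) (poi (s / 4)))).
  by rewrite !conv_poi; congr poi; field.
rewrite -conv_nabl -conv_nabr -conv_nabr -conv_nabl -conv_nabr -conv_nabl.
set y := (Num.sqrt (s / 4))^-1.
have y0 : 0 <= y by rewrite invr_ge0 sqrtr_ge0.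
have -> : 16 / s ^+ 2 = y * (y * (y * y)).
  have -> : y * (y * (y * y)) = (y ^+ 2) ^+ 2 by ring.
  by rewrite exprVn sqr_sqrtr ?(ltW h0)//; field; rewrite gt_eqF.
apply: norm_conv => [|i|i]; rewrite ?mulr_ge0//; first exact: nab_poi_l1.
apply: norm_conv => [|j|j]; rewrite ?mulr_ge0//; first exact: nab_poi_l1.
by apply: norm_conv => [//|h|h]; [exact: nab_poi_l1|exact: poi_le].
Qed.

Lemma sum_ord_const n x : n%:R * x = \sum_(i < n) x.
Proof. by rewrite big_const_ord iter_addr_0 mulr_natl. Qed.

Lemma nab_tele f k n : f (k + n)%N = f k + \sum_(i < n) nab f (k + i).+1.
Proof.
elim: n => [|n IH]; first by rewrite addn0 big_ord0 addr0.
by rewrite big_ord_recr/= addrA -IH /nab/= addnS addrC subrK.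
Qed.

Lemma nab_delay f : nab (delay f) = delay (nab f).
Proof. by apply/funext => -[|[|k]]; rewrite /nab/= ?subr0. Qed.

Lemma nab_iter_delay f n : nab (iter n delay f) = iter n delay (nab f).
Proof. by elim: n => //= n <-; rewrite nab_delay. Qed.

Lemma norm_delay_le f B k : (forall i, `|f i| <= B) -> `|delay f k| <= B.
Proof.
by move=> fB; case: k => [|k]//=; rewrite normr0 (le_trans _ (fB 0%N)).
Qed.

Lemma iter_delay_ge0 f n k : (forall i, 0 <= f i) -> 0 <= iter n delay f k.
Proof. by move=> f0; elim: n k => //= n IH [|k] //=. Qed.

Lemma iter_delayE f n k :
  iter n delay f k = if (n <= k)%N then f (k - n)%N else 0.
Proof.
elim: n k => [|n IH] k; first by rewrite /= subn0.
by case: k => //= k; rewrite IH ltnS subSS.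
Qed.

Lemma iter_delay_taylor1 f B n k : (forall i, `|nab f i| <= B) ->
  `|iter n delay f k - f k| <= n%:R * B.
Proof.
move=> fB; elim: n k => [|n IH] k; first by rewrite subrr normr0 mul0r.
have -> : iter n.+1 delay f k - f k =
    delay (fun j => iter n delay f j - f j) k - nab f k.
  by rewrite /nab; case: k => [|k]/=; ring.
rewrite (le_trans (ler_normB _ _))// -natr1 mulrDl mul1r lerD//.
exact: norm_delay_le.
Qed.

(** [delay] is [1 - nab], so this is [(1 - x)^n = 1 - n x + O(n^2 x^2)]: passing
    from [n] to [n.+1] costs [n] second differences, because
    [(1 - x) (1 - n x) = 1 - (n + 1) x + n x^2]. *)
Lemma iter_delay_taylor2 f B n k : (forall i, `|nab (nab f) i| <= B) ->
  `|iter n delay f k - f k + n%:R * nab f k| <= n%:R ^+ 2 * B.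
Proof.
move=> fB; have B0 : 0 <= B by exact: le_trans (normr_ge0 _) (fB 0%N).
elim: n k => [|n IH] k.
  by rewrite subrr mul0r addr0 normr0 mulr_ge0// sqr_ge0.
have -> : iter n.+1 delay f k - f k + n.+1%:R * nab f k =
    delay (fun j => iter n delay f j - f j + n%:R * nab f j) k
    + n%:R * nab (nab f) k.
  rewrite -natr1; case: k => [|k]; rewrite /nab/=; ring.
rewrite (le_trans (ler_normD _ _))//.
have h1 := norm_delay_le (f := fun j => _) k IH.
rewrite (le_trans (lerD h1 (lexx _)))// normrM normr_nat.
rewrite (le_trans (lerD (lexx _) (ler_wpM2l (ler0n _ _) (fB k))))//.
rewrite -mulrDl ler_wpM2r// -natr1 sqrrD1; have := ler0n R n; nra.
Qed.

Lemma nab_poi_ge0 s k : 0 < s -> k%:R <= s -> 0 <= nab (poi s) k.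
Proof.
move=> s0 ks; rewrite nab_poi// divr_ge0 ?(ltW s0)//.
by rewrite (mulr_ge0 (poi_ge0 _ (ltW s0)))// subr_ge0.
Qed.

Lemma nab_poi_le0 s k : 0 < s -> s <= k%:R -> nab (poi s) k <= 0.
Proof.
move=> s0 ks; rewrite nab_poi// mulr_le0_ge0 ?invr_ge0 ?(ltW s0)//.
by rewrite (mulr_ge0_le0 (poi_ge0 _ (ltW s0)))// subr_le0.
Qed.

Lemma poi_incr s i k : 0 < s -> (i <= k)%N -> k%:R <= s -> poi s i <= poi s k.
Proof.
move=> s0 ik ks; rewrite -(subnKC ik) nab_tele lerDl sumr_ge0// => j _.
rewrite nab_poi_ge0// (le_trans _ ks)// ler_nat.
by rewrite -addnS -leq_subRL// (leq_trans (ltn_ord j)).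
Qed.

Lemma poi_decr s i k : 0 < s -> (i <= k)%N -> s <= i.+1%:R ->
  poi s k <= poi s i.
Proof.
move=> s0 ik ks; rewrite -(subnKC ik) nab_tele gerDl sumr_le0// => j _.
by rewrite nab_poi_le0// (le_trans ks)// ler_nat ltnS leq_addr.
Qed.

Lemma poi_mode s k : 0 < s -> poi s k <= poi s (Num.truncn s).
Proof.
move=> s0; have /andP[h1 h2] := truncn_itv (ltW s0).
case: (leqP k (Num.truncn s)) => h.
  exact: poi_incr.
by apply: poi_decr => //; [exact: ltnW|exact: ltW].
Qed.

(** At most [4 * Num.sqrt s + 2] integers lie within two standard deviations of
    [s]. By Chebyshev's inequality they carry three quarters of the mass, and no
    weight exceeds the one at the mode. *)
Lemma poi_mode_ge s : 1 <= s ->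
  (16 * Num.sqrt s)^-1 <= poi s (Num.truncn s).
Proof.
move=> s1; have s0 : 0 < s by lra.
set y := Num.sqrt s; set p := poi s _.
have y1 : 1 <= y by rewrite -(sqrtr1 R) ler_wsqrtr.
have ys : y ^+ 2 = s by rewrite sqr_sqrtr// ltW.
rewrite leNgt; apply/negP => plt.
have [n nP] : exists n, 15 / 16 <= \sum_(i < n) poi s i.
  have /cvgr_ge/(_ (15 / 16)) := poi_mass_cvg s.
  have -> : (15 / 16 < 1 :> R) by lra.
  move=> /(_ isT) [n _ /(_ n (leqnn n))/= h]; exists n.
  by move: h; rewrite /series/= big_mkord.
pose lo := Num.truncn (s - 2 * y); pose hi := (Num.truncn (s + 2 * y)).+1.
have h2 : \sum_(i < n) poi s i <=
    \sum_(i < n) (poi s i * (i%:R - s) ^+ 2 / (4 * s))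
    + \sum_(i < n | (lo <= i < hi)%N) p.
  rewrite [X in _ + X]big_mkcond -big_split/=; apply: ler_sum => i _.
  have pi0 : 0 <= poi s i by rewrite poi_ge0 ?ltW.
  case: ifPn => [_|out].
    rewrite ler_wpDl ?poi_mode// divr_ge0//; last by lra.
    by rewrite (mulr_ge0 pi0)// sqr_ge0.
  rewrite addr0 ler_pdivlMr ?mulr_gt0// ler_wpM2l//.
  have : 2 * y <= `|i%:R - s|.
    rewrite leNgt; apply: contra out; rewrite ltr_distl => /andP[g1 g2].
    rewrite /hi ltnS /lo; apply/andP; split.
      by rewrite truncn_le_nat; lra.
    by rewrite truncn_ge_nat; lra.
  rewrite -[X in _ -> _ <= X]real_normK ?num_real//; set d := `|_| => yd.
  have -> : 4 * s = (2 * y) ^+ 2 by rewrite -ys; ring.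
  by rewrite lerXn2r ?nnegrE//; lra.
have h3 : \sum_(i < n | (lo <= i < hi)%N) p <= (4 * y + 2) * p.
  rewrite -(big_mkord (fun i => lo <= i < hi)%N (fun=> p)) big_const_seq.
  have p0 : 0 <= p by rewrite poi_ge0 ?ltW.
  rewrite iter_addr_0 -[leLHS]mulr_natl ler_wpM2r//.
  have : (count (fun i => lo <= i < hi) (index_iota 0 n) <= hi - lo)%N.
    rewrite -size_filter -(size_iota lo (hi - lo)); apply: uniq_leq_size.
      exact/filter_uniq/iota_uniq.
    move=> i; rewrite mem_filter => /andP[/andP[li ih] _].
    by rewrite mem_iota li subnKC// (leq_trans li (ltnW ih)).
  rewrite -(ler_nat R) => /le_trans; apply.
  have l1 : s - 2 * y < lo%:R + 1 by rewrite natr1; exact: truncnS_gt.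
  have l2 : hi%:R <= s + 2 * y + 1.
    by rewrite /hi -natr1 lerD2r truncn_le; lra.
  case: (leqP lo hi) => lh; first by rewrite natrB//; lra.
  by move: (ltnW lh); rewrite -subn_eq0 => /eqP ->; lra.
have h4 := poi_var_le n s0.
rewrite -mulr_suml in h2.
have h5 : (\sum_(i < n) poi s i * (i%:R - s) ^+ 2) / (4 * s) <= 1 / 4.
  by rewrite ler_pdivrMr ?mulr_gt0//; lra.
have h6 : (4 * y + 2) * p <= 6 / 16.
  have : (4 * y + 2) * p <= (4 * y + 2) / (16 * y).
    by rewrite ler_wpM2l ?ltW//; lra.
  have : (4 * y + 2) / (16 * y) <= 6 / 16 by rewrite ler_pdivrMr; lra.
  lra.
lra.
Qed.

(** The weights vary by at most [2 / s] per step, so they stay comparable with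
    the maximal one in a window of a small multiple of the standard
    deviation. *)
Lemma poi_near s k : 2 ^+ 11 <= Num.sqrt s ->
  `|k%:R - s| <= Num.sqrt s / 2 ^+ 7 -> (2 ^+ 5 * Num.sqrt s)^-1 <= poi s k.
Proof.
set y := Num.sqrt s => ylarge ks.
have s0 : 0 < s by rewrite -sqrtr_gt0 -/y; lra.
have ys : y ^+ 2 = s by rewrite sqr_sqrtr// ltW.
have s1 : 1 <= s by rewrite -ys; nra.
have h := poi_mode_ge s1; have tb := truncn_itv (ltW s0).
move: h tb; rewrite -/y; set q := Num.truncn s => h /andP[t1 t2].
rewrite -[q.+1%:R]natr1 in t2.
have lip i j : `|poi s (i + j)%N - poi s i| <= j%:R * (2 / s).
  rewrite nab_tele addrC addKr (le_trans (ler_norm_sum _ _ _))//.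
  rewrite sum_ord_const.
  by apply: ler_sum => l _; exact: nab_poi_le.
have lip2 : `|poi s k - poi s q| <= `|k%:R - q%:R| * (2 / s).
  case: (leqP q k) => qk.
    by rewrite -natrB// normr_nat -{1}(subnKC qk).
  have {}qk := ltnW qk.
  by rewrite distrC [X in _ <= X * _]distrC -natrB// normr_nat -{1}(subnKC qk).
have d : `|k%:R - q%:R| <= y / 2 ^+ 7 + 1.
  by move: ks; rewrite !ler_norml => /andP[? ?]; apply/andP; split; lra.
have d2 : `|k%:R - q%:R| * (2 / s) <= (2 ^+ 5 * y)^-1.
  apply: (@le_trans _ _ ((y / 2 ^+ 7 + 1) * (2 / s))).
    by rewrite ler_wpM2r// divr_ge0// ltW.
  rewrite -ys mulrA ler_pdivrMr ?exprn_gt0//; last by lra.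
  have -> : (2 ^+ 5 * y)^-1 * y ^+ 2 = y / 2 ^+ 5 by field; lra.
  lra.
have e : (16 * y)^-1 = (2 ^+ 5 * y)^-1 + (2 ^+ 5 * y)^-1 by field; lra.
by move: lip2; rewrite ler_norml => /andP[? _]; lra.
Qed.

(** Between the two distances [Num.sqrt s / 2 ^+ 9] and [Num.sqrt s / 2 ^+ 8]
    from the mean the weights are still large, hence so are their differences;
    everything further away lies below by the total of those differences. *)
Lemma poi_far s k : 2 ^+ 11 <= Num.sqrt s ->
  Num.sqrt s / 2 ^+ 8 <= `|k%:R - s| ->
  poi s k <= poi s (Num.truncn s) - (2 ^+ 25 * Num.sqrt s)^-1.
Proof.
set y := Num.sqrt s => ylarge ks.
have s0 : 0 < s by rewrite -sqrtr_gt0 -/y; lra.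
have ys : y ^+ 2 = s by rewrite sqr_sqrtr// ltW.
pose t := Num.truncn (y / 2 ^+ 10).
have /andP[t1 t2] : t%:R <= y / 2 ^+ 10 < t%:R + 1.
  by rewrite natr1; apply: truncn_itv; lra.
have t3 : y / 2 ^+ 11 <= t%:R by lra.
pose w := (2 ^+ 14 * y ^+ 2)^-1.
have w0 : 0 < w by rewrite invr_gt0 mulr_gt0 ?exprn_gt0//; lra.
have tw : (2 ^+ 25 * y)^-1 <= t%:R * w.
  apply: (@le_trans _ _ (y / 2 ^+ 11 * w)); last by rewrite ler_wpM2r// ltW.
  rewrite /w le_eqVlt; apply/orP; left; apply/eqP; field; lra.
have nabw i : y / 2 ^+ 9 <= `|i%:R - s| <= y / 2 ^+ 8 ->
    w <= `|nab (poi s) i|.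
  move=> /andP[i1 i2]; rewrite nab_poi// normrM normfV (gtr0_norm s0).
  have hi : `|i%:R - s| <= y / 2 ^+ 7 by lra.
  have p1 := poi_near ylarge hi; rewrite -/y in p1.
  have p2 : 0 <= poi s i by rewrite poi_ge0// ltW.
  rewrite (normrM (poi s i)) (ger0_norm p2) distrC ler_pdivlMr//.
  apply: (@le_trans _ _ ((2 ^+ 5 * y)^-1 * (y / 2 ^+ 9))).
    rewrite /w -ys le_eqVlt; apply/orP; left; apply/eqP; field; lra.
  rewrite ler_pM// ?invr_ge0 ?mulr_ge0//; lra.
have md := poi_mode _ s0.
move: ks; rewrite ler_normr => /orP[ks|ks].
  pose j := (Num.truncn (s + y / 2 ^+ 9)).+1.
  have /andP[j1 j2] : s + y / 2 ^+ 9 < j%:R <= s + y / 2 ^+ 9 + 1.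
    by rewrite truncnS_gt/= /j -[leLHS]natr1 lerD2r truncn_le; lra.
  apply: (@le_trans _ _ (poi s (j + t)%N)).
    apply: poi_decr => //; last by lra.
    by rewrite -(ler_nat R) natrD; lra.
  rewrite nab_tele lerD ?md// lerNr (le_trans tw)//.
  rewrite -sumrN sum_ord_const ler_sum// => i _.
  have it : i.+1%:R <= t%:R :> R by rewrite ler_nat.
  have ji : (j + i).+1%:R = j%:R + i.+1%:R :> R by rewrite -natrD addnS.
  have i0 := ler0n R i.+1.
  have gs : s <= (j + i).+1%:R by rewrite ji; lra.
  have := nabw (j + i).+1; rewrite (ler0_norm (nab_poi_le0 s0 gs)).
  by apply; rewrite ji ger0_norm; [apply/andP; split|]; lra.
have k0 := ler0n R k.
pose j := Num.truncn (s - y / 2 ^+ 9).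
have /andP[j1 j2] : j%:R <= s - y / 2 ^+ 9 < j%:R + 1.
  by rewrite natr1; apply: truncn_itv; lra.
have tj : (k <= j - t)%N /\ (t <= j)%N.
  have kt : (k + t <= j)%N by rewrite -ltnS -(ltr_nat R) -natr1 natrD; lra.
  by split; [rewrite leq_subRL 1?addnC|]; rewrite ?(leq_trans (leq_addl _ _) kt).
case: tj => kjt tj.
apply: (@le_trans _ _ (poi s (j - t)%N)).
  by apply: poi_incr => //; rewrite natrB//; have := ler0n R t; lra.
suff : t%:R * w <= poi s j - poi s (j - t)%N by have := md j; lra.
rewrite -{1}(subnK tj).
rewrite nab_tele addrAC subrr add0r.
rewrite sum_ord_const ler_sum// => i _.
have it : i.+1%:R <= t%:R :> R by rewrite ler_nat.
have ji : (j - t + i).+1%:R = j%:R - t%:R + i.+1%:R :> R.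
  by rewrite -addnS natrD natrB.
have i0 : 1 <= i.+1%:R :> R by rewrite ler1n.
have gs : (j - t + i).+1%:R <= s by rewrite ji; lra.
have := nabw (j - t + i).+1; rewrite (ger0_norm (nab_poi_ge0 s0 gs)).
by apply; rewrite ji ler0_norm; [apply/andP; split|]; lra.
Qed.

Lemma poi_le1 s k : 0 <= s -> poi s k <= 1.
Proof.
move=> s0; apply: le_trans (poi_mass_le1 k.+1 s0).
by rewrite big_ord_recr/= lerDr sumr_ge0// => i _; exact: poi_ge0.
Qed.

Lemma expRN_bounds (p : R) : 0 <= p -> 1 - p <= expR (- p) <= 1 - p + p ^+ 2.
Proof.
move=> p0; have := expR_ge1Dx (- p); have := expR_ge1Dx p => h1 h2.
rewrite h2/=; have e0 : 0 < expR (- p) := expR_gt0 _.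
have e1 : expR (- p) * expR p = 1 by rewrite mulrC expRxMexpNx_1.
have h3 : expR (- p) * (1 + p) <= 1 by rewrite -[leRHS]e1 ler_wpM2l// ltW.
have h4 : 0 <= p * p * p by rewrite !mulr_ge0.
have h5 : 0 < 1 + p by lra.
rewrite -(ler_pM2r h5); lra.
Qed.

(** One Bernoulli step and one Poisson step of the same small mean differ by
    the square of that mean. *)
Lemma poi_step s (p : R) k : 0 <= s -> 0 <= p ->
  `|(1 - p) * poi s k + p * delay (poi s) k - poi (s + p) k| <= 3 * p ^+ 2.
Proof.
move=> s0 p0; have /andP[e1 e2] := expRN_bounds p0.
have q0 : poi p 0 = expR (- p) by rewrite /poi expr0 fact0 divr1 mulr1.
have q1 : poi p 1 = expR (- p) * p by rewrite /poi expr1 divr1.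
rewrite (addrC s p) -conv_poi /conv; case: k => [|k].
  rewrite big_ord1 subn0 q0/= mulr0 addr0 -mulrBl normrM.
  rewrite (@le_trans _ _ (p ^+ 2 * 1))//; last by have := sqr_ge0 p; lra.
  apply: ler_pM => //; last by rewrite ger0_norm ?poi_ge0 ?poi_le1.
  by rewrite ler_norml; have := sqr_ge0 p; lra.
rewrite 2!big_ord_recl/= /bump/= !add1n subn0 subSS subn0 q0 q1.
set A := poi s k.+1; set B := poi s k; set S := \sum_(i < k) _.
have /andP[A0 A1] : 0 <= A <= 1 by rewrite poi_ge0// poi_le1.
have /andP[B0 B1] : 0 <= B <= 1 by rewrite poi_ge0// poi_le1.
have S0 : 0 <= S by apply: sumr_ge0 => i _; rewrite (mulr_ge0 (poi_ge0 _ _) (poi_ge0 _ _)).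
have S1 : S <= p ^+ 2.
  apply: (@le_trans _ _ (\sum_(i < k) poi p i.+2)).
    by apply: ler_sum => i _; rewrite ler_piMr ?poi_ge0 ?poi_le1.
  have := poi_mass_le1 k.+2 p0.
  rewrite 2!big_ord_recl/= /bump/= !add1n q0 q1.
  under eq_bigr do rewrite !add1n.
  nra.
have E1 : 0 <= (expR (- p) - (1 - p)) * A <= p ^+ 2.
  apply/andP; split; first by rewrite mulr_ge0//; lra.
  by rewrite -[leRHS]mulr1 ler_pM//; lra.
have E2 : 0 <= p * (1 - expR (- p)) * B <= p ^+ 2.
  have : expR (- p) <= 1 by rewrite expR_le1; lra.
  move=> e3; have e4 : 0 <= 1 - expR (- p) by lra.
  rewrite (mulr_ge0 (mulr_ge0 p0 e4) B0)/= -[leRHS]mulr1.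
  rewrite (ler_pM (mulr_ge0 p0 e4) B0)// expr2 ler_wpM2l//; lra.
have -> : (1 - p) * A + p * B - (expR (- p) * A + (expR (- p) * p * B + S)) =
  p * (1 - expR (- p)) * B - (expR (- p) - (1 - p)) * A - S by ring.
rewrite ler_norml; lra.
Qed.

End Poisson.
#[global] Opaque poi.

(** * Where a smeared Poisson profile is maximal *)

Section Smear.
Set Implicit Arguments. Unset Strict Implicit.
Context {R : realType}.
Implicit Types (f : nat -> R) (xs : seq nat) (k : nat).

(** When [f] is the law of a variable independent of a uniformly chosen entry of
    [xs], this is the law of their sum. *)
Definition smear xs f k : R :=
  (\sum_(x <- xs) iter x delay f k) / (size xs)%:R.

Definition mean xs : R := (\sum_(x <- xs) x%:R) / (size xs)%:R.

Definition mean_sqr xs : R := (\sum_(x <- xs) x%:R ^+ 2) / (size xs)%:R.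

Lemma nab_smear xs f : nab (smear xs f) = smear xs (nab f).
Proof.
apply/funext => k; rewrite /smear; under eq_bigr do rewrite -nab_iter_delay.
rewrite /nab sumrB mulrBl; case: k => [|k] //=.
by rewrite big1_eq mul0r.
Qed.

Let sum_cst xs (c : R) : (0 < size xs)%N ->
  c = (\sum_(x <- xs) c) / (size xs)%:R.
Proof.
move=> xs0; rewrite big_const_seq count_predT iter_addr_0.
by rewrite -[c *+ _]mulr_natr mulfK// pnatr_eq0 -lt0n.
Qed.

Lemma mean_ge0 xs : 0 <= mean xs.
Proof. by rewrite divr_ge0// sumr_ge0. Qed.

Lemma smear_taylor1 xs f B k : (0 < size xs)%N -> (forall i, `|nab f i| <= B) ->
  `|smear xs f k - f k| <= mean xs * B.
Proof.
move=> xs0 fB; rewrite {1}(sum_cst (f k) xs0) /smear -mulrBl -sumrB.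
rewrite normrM normfV normr_nat /mean -mulrA [X in _ <= _ * X]mulrC mulrA.
rewrite ler_wpM2r ?invr_ge0// mulr_suml (le_trans (ler_norm_sum _ _ _))//.
by apply: ler_sum => x _; exact: iter_delay_taylor1.
Qed.

Lemma smear_taylor2 xs f B k : (0 < size xs)%N ->
  (forall i, `|nab (nab f) i| <= B) ->
  `|smear xs f k - f k + mean xs * nab f k| <= mean_sqr xs * B.
Proof.
move=> xs0 fB; rewrite {1}(sum_cst (f k) xs0) /smear -mulrBl -sumrB.
rewrite /mean /mean_sqr ![_ / _ * _]mulrAC -mulrDl mulr_suml -big_split/=.
rewrite normrM normfV normr_nat ler_wpM2r ?invr_ge0//.
rewrite mulr_suml (le_trans (ler_norm_sum _ _ _))//.
by apply: ler_sum => x _; exact: iter_delay_taylor2.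
Qed.

Lemma nab2_poi (s : R) k : 0 < s ->
  nab (nab (poi s)) k = poi s k * ((s - k%:R) ^+ 2 - k%:R) / s ^+ 2.
Proof.
move=> s0; have s00 : s != 0 by lra.
rewrite {1}/nab nab_poi//; case: k => [|k]/=.
  by rewrite !subr0; field.
rewrite nab_poi//; have := poiSE s k; rewrite -natr1.
set a := poi s k.+1; set b := poi s k => h.
have -> : b = a * (k%:R + 1) / s by rewrite h mulfK.
by field.
Qed.

(** To first order, smearing shifts the argument by [mean xs]: when [k] is near
    [s], the bracket is close to [s + mean xs - k]. The error is a third
    difference of the Poisson law times the second moment of the shifts. *)
Lemma nab_smear_poi xs (s : R) k : (0 < size xs)%N -> 0 < s ->
  `|nab (smear xs (poi s)) k - poi s k / s *
     ((s - k%:R) - mean xs * ((s - k%:R) ^+ 2 - k%:R) / s)|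
  <= mean_sqr xs * (16 / s ^+ 2).
Proof.
move=> xs0 s0; have s00 : s != 0 by lra.
have := @smear_taylor2 xs (nab (poi s)) (16 / s ^+ 2) k xs0 (fun i => nab3_poi_le i s0).
rewrite nab_smear nab2_poi// nab_poi//; congr (`| _ | <= _).
by field.
Qed.

End Smear.

Section Mode.
Set Implicit Arguments. Unset Strict Implicit.
Context {R : realType}.
(* Here [y] is the standard deviation. Near [s] the smeared weights have size
   about [y^-1] and their difference at [k] about [y^-3 * (s + m - k)], so an
   error [eps] below a small multiple of [y^-3] cannot hide the change of sign at
   [s + m]. The half in [a_close] centres the unit interval that ends at [s + m].
   The powers of two are generous margins. *)
Variables (s y : R) (xs : seq nat) (l : nat -> R) (eps a : R).
Hypothesis yE : y = Num.sqrt s.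
Let m : R := mean xs.
Hypothesis xs0 : (0 < size xs)%N.
Hypothesis y_large : 2 ^+ 11 <= y.
Hypothesis m_small : m ^+ 2 <= y / 2 ^+ 60.
Hypothesis m2_small : mean_sqr xs <= y / 2 ^+ 60.
Hypothesis eps_small : eps <= (2 ^+ 60 * y ^+ 3)^-1.
Hypothesis l_close : forall k, `|l k - smear xs (poi s) k| <= eps.
Hypothesis a_close : `|a - (s + m - 2^-1)| <= 8^-1.

Lemma scale_facts : [/\ 0 < y, 0 < s, s = y ^+ 2, 1 <= y & y != 0].
Proof.
have y1 : 1 <= y by apply: le_trans y_large; rewrite exprn_ege1// ler1n.
have y0 : 0 < y by lra.
have s0 : 0 < s by move: y0; rewrite yE sqrtr_gt0.
by split; rewrite ?gt_eqF// yE sqr_sqrtr// ltW.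
Qed.

Lemma mean_small : 0 <= m <= y / 2 ^+ 30.
Proof.
have [y0 _ _ y1 _] := scale_facts; rewrite mean_ge0/=.
rewrite -ler_sqr ?nnegrE ?mean_ge0// ?divr_ge0 ?(ltW y0)//.
apply: le_trans m_small _; rewrite expr_div_n -exprM.
by rewrite ler_wpM2r ?invr_ge0 ?exprn_ge0// expr2 ler_peMl ?(ltW y0)//.
Qed.

(** The Poisson law alone loses [(2 ^+ 25 * y)^-1] between the mode and [k], far
    more than the smearing, which moves each weight by at most [m * (2 / s)],
    and than the error [eps]. *)
Lemma far_from_mean k :
  y / 2 ^+ 8 <= `|k%:R - s| -> l k < l (Num.truncn s).
Proof.
have [y0 s0 ys y1 yn0] := scale_facts; have /andP[m0 my] := mean_small.
have [yl ms ms2 es] := And4 y_large m_small m2_small eps_small.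
move=> kf; have := @poi_far R s k; rewrite -yE => /(_ y_large kf).
have nB i := @nab_poi_le R s i s0.
have h1 := smear_taylor1 k xs0 nB.
have h2 := smear_taylor1 (Num.truncn s) xs0 nB.
have h3 := l_close k; have h4 := l_close (Num.truncn s).
have mb : m * (2 / s) <= (2 ^+ 29 * y)^-1.
  apply: (@le_trans _ _ (y / 2 ^+ 30 * (2 / s))).
    by rewrite ler_wpM2r// divr_ge0// ltW.
  rewrite ys le_eqVlt; apply/orP; left; apply/eqP; field; rewrite ?yn0//.
have eb : eps <= (2 ^+ 29 * y)^-1.
  have h : 2 ^+ 29 * y <= 2 ^+ 60 * y ^+ 3.
    have : 1 * y <= y ^+ 2 * y by rewrite ler_wpM2r ?(ltW y0)// exprn_ege1.
    lra.
  by apply: le_trans eps_small _; rewrite lef_pV2 ?posrE ?mulr_gt0 ?exprn_gt0.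
have -> : (2 ^+ 25 * y)^-1 = 16 * (2 ^+ 29 * y)^-1 by field; rewrite ?yn0//.
have : 0 < (2 ^+ 29 * y)^-1 by rewrite invr_gt0 mulr_gt0.
move: h1 h2 h3 h4 mb eb; rewrite -/m !ler_norml.
set u := (2 ^+ 29 * y)^-1; lra.
Qed.

Lemma bracket_close k :
  `|k%:R - s| <= y / 2 ^+ 7 -> 3 / 8 <= `|k%:R - (s + m)| ->
  `|(s - k%:R) - m * ((s - k%:R) ^+ 2 - k%:R) / s + (k%:R - (s + m))|
  <= `|k%:R - (s + m)| / 4.
Proof.
have [y0 s0 ys y1 yn0] := scale_facts; have /andP[m0 my] := mean_small.
have [yl ms ms2 es] := And4 y_large m_small m2_small eps_small.
set d := k%:R - s; set e := k%:R - (s + m) => dy e38.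
have -> : (s - k%:R) - m * ((s - k%:R) ^+ 2 - k%:R) / s + (k%:R - (s + m)) =
    - (m / s * (d * d - d)).
  by rewrite /e /d; field; rewrite gt_eqF.
rewrite normrN normrM.
have de : `|d| <= `|e| + m.
  by rewrite (_ : d = e + m) ?(le_trans (ler_normD _ _)) ?(ger0_norm m0)// /d /e; ring.
have -> : `|m / s| = m / s by rewrite ger0_norm// divr_ge0// ltW.
apply: (@le_trans _ _ (m / s * (`|d| * (`|e| + m) + `|d|))).
  apply: ler_wpM2l; first by rewrite divr_ge0// ltW.
  apply: le_trans (ler_normB _ _) _; rewrite lerD2r.
  by rewrite normrM ler_wpM2l.
apply: (@le_trans _ _ (m / s * (y / 2 ^+ 7 * (`|e| + m) + y / 2 ^+ 7))).
  apply: ler_wpM2l; first by rewrite divr_ge0// ltW.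
  by rewrite lerD// ler_wpM2r// addr_ge0.
have -> : m / s * (y / 2 ^+ 7 * (`|e| + m) + y / 2 ^+ 7) =
    (m / y * (`|e| + 1) + m ^+ 2 / y) / 2 ^+ 7.
  by rewrite ys ; field.
have h1 : m / y <= 1 / 2 ^+ 30 by rewrite ler_pdivrMr//; lra.
have h2 : m ^+ 2 / y <= 1 / 2 ^+ 60 by rewrite ler_pdivrMr//; lra.
have h3 : m / y * (`|e| + 1) <= 1 / 2 ^+ 30 * (`|e| + 1).
  by rewrite ler_wpM2r//; lra.
lra.
Qed.

(** At distance at least 3/8 from [s + m], the difference of the smeared law has
    the sign of [s + m - k] and exceeds twice the error [eps]; the factor [q] is
    the slope [poi s k / s]. *)
Lemma nab_close k : 3 / 8 <= `|k%:R - (s + m)| -> `|k%:R - s| <= y / 2 ^+ 7 ->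
  exists2 q, `|nab (smear xs (poi s)) k + q * (k%:R - (s + m))|
             <= q * `|k%:R - (s + m)| / 2 & 2 * eps < q / 8.
Proof.
have [y0 s0 ys y1 yn0] := scale_facts; have /andP[m0 my] := mean_small.
have [yl ms ms2 es] := And4 y_large m_small m2_small eps_small.
move=> e38 ky; have b := bracket_close ky e38; set e := k%:R - (s + m) in b e38 *.
have pk : (2 ^+ 5 * y)^-1 <= poi s k by rewrite yE; apply: poi_near; rewrite -yE.
pose q := poi s k / s; exists q; last first.
  rewrite /q mulrAC ltr_pdivlMr//.
  apply: (@le_lt_trans _ _ (2 * (2 ^+ 60 * y ^+ 3)^-1 * s)).
    by rewrite ler_wpM2r ?(ltW s0)// ler_wpM2l.
  apply: (@lt_le_trans _ _ ((2 ^+ 5 * y)^-1 / 8)); last by rewrite ler_wpM2r.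
  rewrite ys; have -> : 2 * (2 ^+ 60 * y ^+ 3)^-1 * y ^+ 2 =
    (2 ^+ 5 * y)^-1 / 2 ^+ 54 by field; rewrite ?yn0//.
  have : 0 < (2 ^+ 5 * y)^-1 by rewrite invr_gt0 mulr_gt0.
  lra.
have q0 : (2 ^+ 5 * y ^+ 3)^-1 <= q.
  rewrite /q ler_pdivlMr// (le_trans _ pk)// ys.
  by rewrite le_eqVlt; apply/orP; left; apply/eqP; field; rewrite ?yn0//.
have h := nab_smear_poi k xs0 s0; rewrite -/m -/q in h.
have u0 : 0 < (2 ^+ 5 * y ^+ 3)^-1 by rewrite invr_gt0 mulr_gt0 ?exprn_gt0.
have h2 : mean_sqr xs * (16 / s ^+ 2) <= q / 32.
  apply: (@le_trans _ _ (y / 2 ^+ 60 * (16 / s ^+ 2))).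
    by rewrite ler_wpM2r// divr_ge0// sqr_ge0.
  have -> : y / 2 ^+ 60 * (16 / s ^+ 2) = (2 ^+ 5 * y ^+ 3)^-1 / 2 ^+ 51.
    by rewrite ys ; field.
  lra.
move: h b; set br := _ - _ / s; set N := nab _ k => h b.
have -> : N + q * e = (N - q * br) + q * (br + e) by ring.
rewrite (le_trans (ler_normD _ _))// normrM (gtr0_norm (lt_le_trans u0 q0)).
have : q * `|br + e| <= q * (`|e| / 4) by rewrite ler_wpM2l//; lra.
have : q * (3 / 8) <= q * `|e| by rewrite ler_wpM2l//; lra.
lra.
Qed.

(** A maximiser at distance at least one from [a] would be beaten by the Poisson
    mode if it were far from [s], and otherwise by its neighbour on the side
    of [a]. *)
Lemma mode_close k : (forall j, l j <= l k) -> a - 1 < k%:R < a + 1.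
Proof.
have [y0 s0 ys y1 yn0] := scale_facts; have /andP[m0 my] := mean_small.
have [yl ms ms2 es] := And4 y_large m_small m2_small eps_small.
move=> lk; have := a_close; rewrite ler_norml => /andP[a1 a2].
have nofar : `|k%:R - s| < y / 2 ^+ 8.
  by rewrite ltNge; apply/negP => /far_from_mean; rewrite ltNge lk.
apply/andP; split; rewrite ltNge; apply/negP => ka.
  have e : k.+1%:R - (s + m) <= - (3 / 8) by rewrite -[k.+1%:R]natr1; lra.
  have [||q] := @nab_close k.+1; first by rewrite ler0_norm; lra.
    rewrite -[k.+1%:R]natr1; move: nofar; rewrite ltr_norml ler_norml; lra.
  have e0 : k.+1%:R - (s + m) <= 0 by lra.
  rewrite (ler0_norm e0).
  have h0 := lk k.+1; have h1 := l_close k; have h2 := l_close k.+1.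
  rewrite [nab _ _]/nab/= => h3 h4.
  have q0 : 0 <= q by have := le_trans (normr_ge0 _) h1; lra.
  move: h1 h2 h3; rewrite !ler_norml; set e' := _ - (s + m) in e e0 *.
  have : q * (3 / 8) <= q * - e' by rewrite ler_wpM2l//; lra.
  lra.
case: k lk nofar ka => [|k] lk nofar ka; first by nra.
have e : 3 / 8 <= k.+1%:R - (s + m) by lra.
have [||q] := @nab_close k.+1; first by rewrite ger0_norm; lra.
  by lra.
have e0 : 0 <= k.+1%:R - (s + m) by lra.
rewrite (ger0_norm e0).
have h0 := lk k; have h1 := l_close k; have h2 := l_close k.+1.
rewrite [nab _ _]/nab/= => h3 h4.
have q0 : 0 <= q by have := le_trans (normr_ge0 _) h1; lra.
move: h1 h2 h3; rewrite !ler_norml; set e' := _ - (s + m) in e e0 *.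
have : q * (3 / 8) <= q * e' by rewrite ler_wpM2l//; lra.
lra.
Qed.

End Mode.

(** * Growing a tree at a uniform external node *)

Section Growth.
Set Implicit Arguments. Unset Strict Implicit.
Implicit Types (t : bst) (v : node).

Definition depths t : seq nat := [seq depth v | v <- external_nodes t].

Definition prof t k : nat := count (fun v => depth v == k) (external_nodes t).

Lemma external_nodes_gt0 t : (0 < size (external_nodes t))%N.
Proof.
by elim: t => //= l IHl r _; rewrite size_cat !size_map addn_gt0 IHl.
Qed.

Lemma external_nodes_uniq t : uniq (external_nodes t).
Proof.
elim: t => //= l IHl r IHr; rewrite cat_uniq.
rewrite !map_inj_uniq ?IHl ?IHr ?andbT/=; try by move=> ? ? [].
by apply/hasPn => _ /mapP[v _ ->]; apply/mapP => -[].
Qed.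

(** The picked node is put back on the left and its two children are added on
    the right, so that no node has to be removed from a list. *)
Lemma perm_grow t v : v \in external_nodes t ->
  perm_eq (v :: external_nodes (grow t v))
          (rcons v false :: rcons v true :: external_nodes t).
Proof.
have consI b : injective (@cons bool b) by move=> ? ? [].
elim: t v => [|l IHl r IHr] [|[] v]//=.
- by rewrite mem_cat => /orP[] /mapP[].
- rewrite mem_cat => /orP[/mapP[?]//|].
  rewrite (mem_map (consI true)) => ur.
  have := perm_map (cons true) (IHr _ ur); rewrite /= => h.
  rewrite (perm_catCA [:: true :: v]) perm_sym.
  rewrite (perm_catCA [:: true :: rcons v false; true :: rcons v true]) perm_sym.
  by rewrite perm_cat2l.
- rewrite mem_cat => /orP[|/mapP[?]//].
  rewrite (mem_map (consI false)) => ul.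
  have := perm_map (cons false) (IHl _ ul); rewrite /= => h.
  by rewrite -!cat_cons perm_cat2r.
Qed.

Lemma size_grow t v : v \in external_nodes t ->
  size (external_nodes (grow t v)) = (size (external_nodes t)).+1.
Proof. by move=> /perm_grow/perm_size [->]. Qed.

Lemma grow_prof t v k : v \in external_nodes t ->
  (prof (grow t v) k <= prof t k + 2)%N /\ (prof t k <= prof (grow t v) k + 2)%N.
Proof.
move=> /perm_grow/permP/(_ (fun v => depth v == k)) /=.
rewrite -/(prof _ _) -/(prof _ _).
by case: eqP => _; case: eqP => _; case: eqP => _ /= h; split; lia.
Qed.

Lemma prof_gt0_size t k : (0 < prof t k)%N -> (k < size (external_nodes t))%N.
Proof.
rewrite -has_count => /hasP[v]; elim: t v k => [|l IHl r IHr] v k /=.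
  by rewrite inE => /eqP -> /eqP <-.
rewrite mem_cat size_cat !size_map => /orP[] /mapP[u ul ->] /eqP <- /=.
  by rewrite -[X in (X < _)%N]addn1 -addSn leq_add ?external_nodes_gt0// (IHl u).
by rewrite -[X in (X < _)%N]add1n -addnS leq_add ?external_nodes_gt0// (IHr u).
Qed.

End Growth.

Section Average.
Set Implicit Arguments. Unset Strict Implicit.
Context {R : realType}.
Implicit Types (t : bst) (v : node) (f g : bst -> R).

Lemma sum_grow t v (f : node -> R) : v \in external_nodes t ->
  \sum_(u <- external_nodes (grow t v)) f u =
  \sum_(u <- external_nodes t) f u - f v + (f (rcons v false) + f (rcons v true)).
Proof.
move=> /perm_grow h; have := perm_big _ h; rewrite /= => /(_ R +%R 0 predT f).
rewrite !big_cons/= => /(canRL (addKr _)) ->; ring.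
Qed.

(** The conditional expectation of [f] at the tree [r] steps later, given that
    the current tree is [t]. *)
Fixpoint growth_mean r t f : R :=
  if r is r'.+1 then
    (\sum_(v <- external_nodes t) growth_mean r' (grow t v) f)
      / (size (external_nodes t))%:R
  else f t.

Lemma growth_meanD r t f g :
  growth_mean r t (fun u => f u + g u) = growth_mean r t f + growth_mean r t g.
Proof.
elim: r t => //= r IH t; rewrite -mulrDl -big_split/=.
by under eq_bigr do rewrite IH.
Qed.

Lemma growth_meanZ r t c f :
  growth_mean r t (fun u => c * f u) = c * growth_mean r t f.
Proof.
elim: r t => //= r IH t; under eq_bigr do rewrite IH.
by rewrite -mulr_sumr mulrA.
Qed.

Lemma growth_mean_cst r t c : growth_mean r t (fun=> c) = c.
Proof.
elim: r t => //= r IH t; under eq_bigr do rewrite IH.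
rewrite big_const_seq count_predT iter_addr_0 -[c *+ _]mulr_natr mulfK//.
by rewrite pnatr_eq0 -lt0n external_nodes_gt0.
Qed.

Lemma growth_mean_le r t n f g : size (external_nodes t) = n ->
  (forall u, size (external_nodes u) = (r + n)%N -> f u <= g u) ->
  growth_mean r t f <= growth_mean r t g.
Proof.
elim: r t n => [|r IH] t n tn fg /=; first exact: fg.
rewrite ler_wpM2r ?invr_ge0// big_seq [leRHS]big_seq ler_sum// => v vt.
by apply: (IH _ n.+1); rewrite ?size_grow ?tn// addnS.
Qed.

Lemma eq_growth_mean r t f g : f =1 g -> growth_mean r t f = growth_mean r t g.
Proof. by move=> /funext ->. Qed.

Lemma growth_mean_sum r t (I : Type) (s : seq I) (F : I -> bst -> R) :
  growth_mean r t (fun u => \sum_(i <- s) F i u) =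
  \sum_(i <- s) growth_mean r t (F i).
Proof.
elim: s => [|i s IH].
  by under eq_growth_mean do rewrite big_nil; rewrite growth_mean_cst big_nil.
by under eq_growth_mean do rewrite big_cons; rewrite growth_meanD IH big_cons.
Qed.

End Average.


(** * The conditional mean profile and the fluctuations around it *)

Section Kernel.
Set Implicit Arguments. Unset Strict Implicit.
Context {R : realType}.
Implicit Types (t : bst) (v : node) (l r k N : nat).

Definition hop l : R := 2 / l.+2%:R.

(** The law of the number of levels that separate a uniformly chosen external
    node, after [r] steps, from its ancestor in a tree with [l.+1] external
    nodes: two of the [j.+2] external nodes present after a step at size [j.+1]
    are new, whence independent Bernoulli gains of parameters [hop l], ...,
    [hop (l + r).-1]. *)
Fixpoint kernel l r : nat -> R :=
  if r is r'.+1 then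
    fun k => (1 - hop l) * kernel l.+1 r' k + hop l * delay (kernel l.+1 r') k
  else fun k => (k == 0%N)%:R.

Fixpoint hop_sum l r : R := if r is r'.+1 then hop_sum l.+1 r' + hop l else 0.

Lemma hop_ge0 l : 0 <= hop l. Proof. exact: divr_ge0. Qed.

Lemma hop_le1 l : hop l <= 1.
Proof. by rewrite ler_pdivrMr ?ltr0n// mul1r ler_nat. Qed.

Lemma hop_sum_ge0 l r : 0 <= hop_sum l r.
Proof. by elim: r l => //= r IH l; rewrite addr_ge0// hop_ge0. Qed.

Lemma delay_ge0 (f : nat -> R) k : (forall i, 0 <= f i) -> 0 <= delay f k.
Proof. by move=> f0; case: k => /=. Qed.

Lemma kernel_ge0 l r k : 0 <= kernel l r k.
Proof.
elim: r l k => [|r IH] l k /=; first by rewrite ler0n.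
by rewrite addr_ge0// mulr_ge0 ?hop_ge0 ?delay_ge0// subr_ge0 hop_le1.
Qed.

Lemma sum_delay_le (f : nat -> R) N (c : R) : (forall M, \sum_(k < M) f k <= c) ->
  \sum_(k < N) delay f k <= c.
Proof.
move=> fc; case: N => [|N]; first by have := fc 0%N; rewrite !big_ord0.
by rewrite big_ord_recl/= add0r; apply: fc.
Qed.

Lemma kernel_mass l r N : \sum_(k < N) kernel l r k <= 1.
Proof.
elim: r l N => [|r IH] l N /=.
  case: N => [|N]; first by rewrite big_ord0 ler01.
  by rewrite big_ord_recl big1 ?addr0.
rewrite big_split/= -!mulr_sumr.
have h1 := IH l.+1 N; have h2 := sum_delay_le N (IH l.+1).
have := hop_ge0 l; have := hop_le1 l => a b.
have : (1 - hop l) * \sum_(i < N) kernel l.+1 r i <= (1 - hop l) * 1.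
  by rewrite ler_wpM2l//; lra.
have : hop l * \sum_(i < N) delay (kernel l.+1 r) i <= hop l * 1.
  by rewrite ler_wpM2l//; lra.
lra.
Qed.

Lemma kernel_support l r k : (r < k)%N -> kernel l r k = 0.
Proof.
elim: r l k => [|r IH] l [|k]//= rk.
by rewrite (IH _ k.+1 (ltnW rk)) (IH _ k rk) !mulr0 addr0.
Qed.

Lemma inv_sqr_sum l r :
  \sum_(j < r) (l + j).+2%:R^-1 ^+ 2 <= l.+1%:R^-1 - (l + r).+1%:R^-1 :> R.
Proof.
elim: r => [|r IH]; first by rewrite big_ord0 addn0 subrr.
rewrite big_ord_recr/=; apply: le_trans (lerD IH (lexx _)) _.
rewrite addnS -addrA lerD2l -[(l + r).+2%:R]natr1.
set x := (l + r).+1%:R : R; have x0 : 0 < x by rewrite ltr0n.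
have -> : - x^-1 + (x + 1)^-1 ^+ 2 = - (x + 1)^-1 - (x * (x + 1) ^+ 2)^-1.
  by field; lra.
by rewrite gerBl invr_ge0 mulr_ge0 ?sqr_ge0// ltW.
Qed.

(** Each Bernoulli gain is replaced by a Poisson one at the cost of the square
    of its parameter, and these squares have a convergent sum. *)
Lemma kernel_poi l r k : `|kernel l r k - poi (hop_sum l r) k| <= 12 / l.+1%:R.
Proof.
suff : `|kernel l r k - poi (hop_sum l r) k| <=
    12 * \sum_(j < r) (l + j).+2%:R^-1 ^+ 2.
  move=> /le_trans; apply; rewrite ler_wpM2l// (le_trans (inv_sqr_sum _ _))//.
  by rewrite gerBl invr_ge0.
elim: r l k => [|r IH] l k.
  by rewrite big_ord0 mulr0 /= poi_mean0 subrr normr0.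
rewrite big_ord_recl/= addn0; under eq_bigr do rewrite /bump/= add1n addnS -addSn.
set S := \sum_(i < r) _; set s := hop_sum _ _; set f := kernel _ _.
have S0 : 0 <= S by apply: sumr_ge0 => i _; exact: sqr_ge0.
have h1 i : `|f i - poi s i| <= 12 * S := IH l.+1 i.
have h2 : `|delay (fun i => f i - poi s i) k| <= 12 * S := norm_delay_le k h1.
have h3 := @poi_step R s (hop l) k (hop_sum_ge0 _ _) (hop_ge0 _).
have -> : (1 - hop l) * f k + hop l * delay f k - poi (s + hop l) k =
  (1 - hop l) * (f k - poi s k) + hop l * delay (fun i => f i - poi s i) k +
  ((1 - hop l) * poi s k + hop l * delay (poi s) k - poi (s + hop l) k).
  by case: (k) => [|k'] /=; ring.
have a := hop_ge0 l; have b := hop_le1 l.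
rewrite (le_trans (ler_normD _ _))// (le_trans (lerD (ler_normD _ _) h3))//.
have a1 : 0 <= 1 - hop l by lra.
rewrite (normrM (1 - _)) (normrM (hop l)) (ger0_norm a) (ger0_norm a1).
have -> : 12 * (l.+2%:R^-1 ^+ 2 + S) =
    ((1 - hop l) * (12 * S) + hop l * (12 * S)) + 3 * hop l ^+ 2.
  have x0 : l.+2%:R != 0 :> R by rewrite pnatr_eq0.
  by rewrite /hop; move: (l.+2%:R) x0 => x x0; field.
by rewrite lerD2r lerD// ler_wpM2l//; lra.
Qed.

Lemma size_depths t : size (depths t) = size (external_nodes t).
Proof. exact: size_map. Qed.

Lemma sum_depths t (F : nat -> R) :
  \sum_(x <- depths t) F x = \sum_(v <- external_nodes t) F (size v).
Proof. by rewrite big_map. Qed.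

Lemma smear_prof t k :
  (size (external_nodes t))%:R * smear (depths t) (kernel 0 0) k =
  (prof t k)%:R :> R.
Proof.
rewrite /smear size_depths mulrC divfK ?pnatr_eq0 -?lt0n ?external_nodes_gt0//.
rewrite sum_depths /prof -sum1_count natr_sum [RHS]big_mkcond/=.
apply: eq_bigr => v _; rewrite iter_delayE /depth.
rewrite subn_eq0 eqn_leq; case: leqP => //= _.
by case: (k <= size v)%N.
Qed.

Lemma iter_delay_kernel x l r k :
  iter x delay (kernel l r.+1) k =
  (1 - hop l) * iter x delay (kernel l.+1 r) k
  + hop l * iter x.+1 delay (kernel l.+1 r) k.
Proof.
elim: x k => //= x IH [|k] /=; last by rewrite IH.
by rewrite !mulr0 addr0.
Qed.

Lemma smear_grow t v l r k : v \in external_nodes t ->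
  size (external_nodes t) = l.+1 ->
  smear (depths (grow t v)) (kernel l.+1 r) k =
  (\sum_(u <- external_nodes t) iter (size u) delay (kernel l.+1 r) k
   + (2 * iter (size v).+1 delay (kernel l.+1 r) k
      - iter (size v) delay (kernel l.+1 r) k)) / l.+2%:R.
Proof.
move=> vt tl; rewrite /smear size_depths size_grow// tl; congr (_ / _).
rewrite sum_depths.
have := @sum_grow R t v (fun u => iter (size u) delay (kernel l.+1 r) k) vt.
rewrite !size_rcons => ->; ring.
Qed.

Lemma smear_step t l r k : size (external_nodes t) = l.+1 ->
  (\sum_(v <- external_nodes t) smear (depths (grow t v)) (kernel l.+1 r) k)
    / l.+1%:R = smear (depths t) (kernel l r.+1) k :> R.
Proof.
move=> tl; rewrite big_seq; under eq_bigr do rewrite smear_grow//.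
rewrite -big_seq -mulr_suml big_split/= big_const_seq count_predT tl.
rewrite iter_addr_0 -[_ *+ _]mulr_natl sumrB -mulr_sumr.
rewrite /smear size_depths tl sum_depths.
under [in RHS]eq_bigr do rewrite iter_delay_kernel.
rewrite big_split/= -!mulr_sumr; congr (_ / _).
set S := \sum_(v <- _) _; set S' := \sum_(v <- _) _.
rewrite /hop; have x0 : l.+2%:R != 0 :> R by rewrite pnatr_eq0.
have -> : l.+1%:R = l.+2%:R - 1 :> R by rewrite -[l.+2%:R]natr1 addrK.
by move: (l.+2%:R) x0 => x x0; field.
Qed.

(** The kernel is the conditional mean profile: averaging over one growth step
    composes the translates with one more Bernoulli gain. *)
Lemma growth_mean_prof r t l k : size (external_nodes t) = l.+1 ->
  growth_mean r t (fun u => (prof u k)%:R) =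
  (l + r).+1%:R * smear (depths t) (kernel l r) k.
Proof.
elim: r t l => [|r IH] t l tl; first by rewrite /= addn0 -tl -smear_prof.
rewrite /= big_seq; under eq_bigr => v vt.
  rewrite (IH _ l.+1); last by rewrite size_grow ?tl.
  rewrite addSnnS; over.
by rewrite -big_seq -mulr_sumr -mulrA tl smear_step.
Qed.

Lemma sum_smear_spread x l r N :
  \sum_(k < N) (2 * iter x.+1 delay (kernel l r) k
     - iter x delay (kernel l r) k) ^+ 2 <= 10 :> R.
Proof.
have mass y M : \sum_(k < M) iter y delay (kernel l r) k <= 1.
  elim: y M => [|y IH] M; first exact: kernel_mass.
  exact: sum_delay_le.
have K0 y k : 0 <= iter y delay (kernel l r) k <= 1.
  have p0 i := iter_delay_ge0 y i (kernel_ge0 l r); rewrite p0/=.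
  apply: le_trans (mass y k.+1); rewrite big_ord_recr/= lerDr.
  by apply: sumr_ge0.
apply: (@le_trans _ _ (\sum_(k < N) (8 * iter x.+1 delay (kernel l r) k
     + 2 * iter x delay (kernel l r) k))).
  apply: ler_sum => k _; have := K0 x k; have := K0 x.+1 k.
  set a := iter _ _ _ _; set b := iter _ _ _ _ => /andP[a0 a1] /andP[b0 b1].
  have : 0 <= a * (1 - a) by rewrite mulr_ge0//; lra.
  have : 0 <= b * (1 - b) by rewrite mulr_ge0//; lra.
  have : 0 <= (2 * a + b) ^+ 2 by exact: sqr_ge0.
  lra.
rewrite big_split/= -!mulr_sumr; have := mass x.+1 N; have := mass x N; lra.
Qed.

Lemma avg_le (I : eqType) (s : seq I) (F : I -> R) (c : R) :
  (0 < size s)%N -> (forall i, i \in s -> F i <= c) ->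
  (\sum_(i <- s) F i) / (size s)%:R <= c.
Proof.
move=> s0 Fc; rewrite ler_pdivrMr ?ltr0n// mulr_natr -iter_addr_0.
by rewrite -count_predT -big_const_seq big_seq [leRHS]big_seq ler_sum.
Qed.

Lemma sqr_avg_le (I : eqType) (s : seq I) (B : I -> R) (a c : R) :
  (0 < size s)%N -> a = (\sum_(i <- s) B i) / (size s)%:R ->
  (\sum_(i <- s) (B i - a) ^+ 2) / (size s)%:R <=
  (\sum_(i <- s) (B i - c) ^+ 2) / (size s)%:R.
Proof.
move=> s0 aE; rewrite ler_wpM2r ?invr_ge0// -subr_ge0 -sumrB.
have n0 : (size s)%:R != 0 :> R by rewrite pnatr_eq0 -lt0n.
have -> : \sum_(i <- s) ((B i - c) ^+ 2 - (B i - a) ^+ 2) =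
    (size s)%:R * (a - c) ^+ 2.
  under eq_bigr => i _.
    rewrite (_ : _ - _ = 2 * (a - c) * B i + (c ^+ 2 - a ^+ 2)); last by ring.
    over.
  rewrite big_split/= -mulr_sumr big_const_seq count_predT iter_addr_0.
  have -> : \sum_(i <- s) B i = a * (size s)%:R by rewrite aE mulfVK.
  by rewrite -[_ *+ _]mulr_natl; ring.
by rewrite mulr_ge0// sqr_ge0.
Qed.

(** The predictions of the final profile form a martingale, whose increments are
    orthogonal. Growing a tree at one of its [l.+1] external nodes changes the
    prediction only through the [(l + r).+1 / l.+2] descendants that an external
    node has on average at the end; the distribution of their depths has mass
    one and values at most one, so its squares have a bounded sum over the
    levels. *)
Lemma growth_variance r t l N : size (external_nodes t) = l.+1 ->
  growth_mean r t (fun u => \sum_(k < N)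
    ((prof u k)%:R - (l + r).+1%:R * smear (depths t) (kernel l r) k) ^+ 2) <=
  10 * (l + r).+1%:R ^+ 2 * \sum_(j < r) (l + j).+2%:R^-1 ^+ 2 :> R.
Proof.
elim: r t l => [|r IH] t l tl /=.
  rewrite big_ord0 mulr0 big1// => k _.
  by rewrite addn0 -tl -smear_prof subrr expr0n.
set n1 := (l + r.+1).+1%:R : R.
pose B v k : R := n1 * smear (depths (grow t v)) (kernel l.+1 r) k.
pose A k : R := n1 * smear (depths t) (kernel l r.+1) k.
have AE k : A k = (\sum_(v <- external_nodes t) B v k)
    / (size (external_nodes t))%:R.
  by rewrite /A /B -mulr_sumr -mulrA tl smear_step.
have split v : v \in external_nodes t ->
    growth_mean r (grow t v) (fun u => \sum_(k < N) ((prof u k)%:R - A k) ^+ 2)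
    = growth_mean r (grow t v)
        (fun u => \sum_(k < N) ((prof u k)%:R - B v k) ^+ 2)
      + \sum_(k < N) (B v k - A k) ^+ 2.
  move=> vt; rewrite !growth_mean_sum -big_split/=; apply: eq_bigr => k _.
  have E : (fun u => ((prof u k)%:R - A k) ^+ 2) =
    (fun u => ((prof u k)%:R - B v k) ^+ 2
       + (2 * (B v k - A k) * (prof u k)%:R
          + (A k ^+ 2 - B v k ^+ 2))).
    by apply/funext => u; ring.
  rewrite E growth_meanD growth_meanD growth_meanZ growth_mean_cst.
  rewrite (growth_mean_prof r k (l := l.+1)) ?size_grow ?tl//.
  by rewrite addSnnS -/(B v k); ring.
rewrite big_seq; under eq_bigr => v vt do rewrite split//.
rewrite -big_seq big_split/= mulrDl big_ord_recl/= mulrDr addrC lerD//.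
  have -> : (\sum_(v <- external_nodes t) \sum_(k < N) (B v k - A k) ^+ 2)
      / (size (external_nodes t))%:R =
    \sum_(k < N) (\sum_(v <- external_nodes t) (B v k - A k) ^+ 2)
      / (size (external_nodes t))%:R by rewrite exchange_big mulr_suml.
  (* The conditional mean [A] may be replaced by the part [c] of [B v] that does
     not depend on [v]. *)
  pose c k : R := n1 / l.+2%:R
    * \sum_(u <- external_nodes t) iter (size u) delay (kernel l.+1 r) k.
  apply: (@le_trans _ _ (\sum_(k < N)
      (\sum_(v <- external_nodes t) (B v k - c k) ^+ 2)
      / (size (external_nodes t))%:R)).
    by apply: ler_sum => k _; apply: sqr_avg_le (AE k); exact: external_nodes_gt0.
  rewrite -mulr_suml exchange_big/=; apply: avg_le => [|v vt].
    exact: external_nodes_gt0.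
  have E k : (B v k - c k) ^+ 2 = (n1 / l.+2%:R) ^+ 2
      * (2 * iter (size v).+1 delay (kernel l.+1 r) k
        - iter (size v) delay (kernel l.+1 r) k) ^+ 2.
    by rewrite /B /c smear_grow//; ring.
  under eq_bigr do rewrite E.
  rewrite -mulr_sumr addn0 -mulrA -exprMn mulrC.
  by rewrite ler_wpM2r ?sqr_ge0// sum_smear_spread.
apply: avg_le => [|v vt]; first exact: external_nodes_gt0.
under [in leRHS]eq_bigr do rewrite /bump/= add1n addnS -addSn.
have := IH (grow t v) l.+1; rewrite size_grow// tl => /(_ erefl).
by rewrite addSnnS.
Qed.

Lemma ln_nat_step l :
  l.+2%:R^-1 <= ln l.+2%:R - ln (l.+1%:R : R) <= l.+1%:R^-1.
Proof.
have x0 : 0 < l.+1%:R :> R by rewrite ltr0n.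
rewrite -[l.+2%:R]natr1; set x := l.+1%:R in x0 *.
have y0 : 0 < x + 1 by lra.
apply/andP; split.
  have /le_ln1Dx : -1 < - (x + 1)^-1 by rewrite ltrN2 invf_lt1//; lra.
  have -> : 1 - (x + 1)^-1 = x / (x + 1) by field; lra.
  by rewrite ln_div//; lra.
have /le_ln1Dx : -1 < x^-1 by rewrite (lt_trans _ (_ : 0 < x^-1)) ?invr_gt0//; lra.
have -> : 1 + x^-1 = (x + 1) / x by field; lra.
by rewrite ln_div.
Qed.

(** The gains sum to twice a piece of the harmonic series. *)
Lemma hop_sum_ln l r :
  `|hop_sum l r - 2 * (ln (l + r).+1%:R - ln l.+1%:R)| <= 2 / l.+1%:R.
Proof.
suff : 0 <= 2 * (ln (l + r).+1%:R - ln l.+1%:R) - hop_sum l r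
    <= 2 * (l.+1%:R^-1 - (l + r).+1%:R^-1).
  have : 0 < (l + r).+1%:R^-1 :> R by rewrite invr_gt0 ltr0n.
  set a := hop_sum _ _; set b := ln _; set c := ln _; set u := _^-1; set w := _^-1.
  by move=> h /andP[h1 h2]; rewrite distrC ger0_norm//; lra.
elim: r l => [|r IH] l /=; first by rewrite addn0 !subrr !mulr0 subrr lexx.
have := IH l.+1; have := ln_nat_step l; rewrite addSnnS /hop.
set s := hop_sum _ _.
set a := ln (l + r.+1).+1%:R; set b := ln _.+1%:R; set c := ln l.+1%:R.
set u := _.+2%:R^-1; set w := _.+1%:R^-1; set z := _.+1%:R^-1.
move=> /andP[? ?] /andP[? ?].
by apply/andP; split; lra.
Qed.

Lemma growth_variance_le r t l N : size (external_nodes t) = l.+1 ->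
  growth_mean r t (fun u => \sum_(k < N)
    ((prof u k)%:R - (l + r).+1%:R * smear (depths t) (kernel l r) k) ^+ 2) <=
  10 * (l + r).+1%:R ^+ 2 / l.+1%:R :> R.
Proof.
move=> tl; apply: le_trans (growth_variance r N tl) _.
rewrite ler_wpM2l ?mulr_ge0 ?sqr_ge0// (le_trans (inv_sqr_sum _ _))//.
by rewrite gerBl invr_ge0.
Qed.

End Kernel.

(** * From growth means to probabilities *)

Section Process.
Set Implicit Arguments. Unset Strict Implicit.
Context {R : realType} {d : measure_display} {T : measurableType d}.
Context {P : probability T R} {pick : nat -> T -> node}.
Hypothesis Hpick : bst_process P pick.
Local Notation tree := (bst_tree pick).
Implicit Types (n r s k : nat) (h : nat -> node) (A : set T).

(** Every event below is determined by finitely many picks, which take countably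
    many values, so that its measurability needs no structure on the set of
    trees. *)
Lemma countable_fibers_measurable (C : countType) (X : T -> C) (A : set C) :
  (forall c, measurable [set w | X w = c]) -> measurable [set w | A (X w)].
Proof.
move=> mX; have -> : [set w | A (X w)] =
    \bigcup_c (if `[< A c >] then [set w | X w = c] else set0).
  apply/seteqP; split => [w Aw|w [c _]] /=.
    by exists (X w) => //; case: asboolP.
  by case: asboolP => [Ac /= ->|].
apply: countable_bigcupT_measurable => // c.
by case: ifP.
Qed.

Definition history n w : seq node := [seq pick k w | k <- iota 0 n].

Arguments history : simpl never.

Lemma historyS n w : history n.+1 w = rcons (history n w) (pick n w).
Proof.
have e : iota 0 n.+1 = rcons (iota 0 n) n by rewrite -addn1 iotaD cats1.
by rewrite /history e map_rcons.
Qed.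

Definition tree_of (s : seq node) : bst := grow_seq (nth [::] s) (size s).

Lemma eq_grow_seq h h' n : (forall k, (k < n)%N -> h k = h' k) ->
  grow_seq h n = grow_seq h' n.
Proof.
elim: n => //= n IH hh; rewrite hh// IH// => k kn.
by rewrite hh// ltnS ltnW.
Qed.

Lemma tree_history n w : tree n w = tree_of (history n w).
Proof.
rewrite /tree_of size_map size_iota; apply: eq_grow_seq => k kn.
by rewrite (nth_map 0%N) ?size_iota// nth_iota.
Qed.

Lemma history_measurable n (A : set (seq node)) :
  measurable [set w | A (history n w)].
Proof.
apply: countable_fibers_measurable => c.
elim: n c => [|n IH] c.
  have [->|c0] := eqVneq c [::].
    by rewrite (_ : [set _ | _] = setT)//; apply/seteqP; split.
  rewrite (_ : [set _ | _] = set0)//; apply/seteqP; split => //= w /esym/eqP.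
  by rewrite (negbTE c0).
case: (lastP c) => [|c' v].
  rewrite (_ : [set _ | _] = set0)//; by apply/seteqP; split => //= w.
rewrite (_ : [set _ | _] =
    [set w | history n w = c'] `&` [set w | pick n w = v]).
  by apply: measurableI => //; exact: (pick_measurable Hpick).
apply/seteqP; split => w /=; rewrite historyS.
  by move=> /rcons_inj[].
by move=> [-> ->].
Qed.

Lemma tree_measurable n (A : set bst) : measurable [set w | A (tree n w)].
Proof.
have := history_measurable n [set s | A (tree_of s)].
by congr measurable; apply/seteqP; split => w /=; rewrite tree_history.
Qed.

Lemma two_trees_measurable s r (Q : bst -> bst -> Prop) :
  measurable [set w | Q (tree s w) (tree (s + r) w)].
Proof.
have := history_measurable (s + r)
  [set c | Q (tree_of (take s c)) (tree_of c)].
congr measurable; apply/seteqP; split => w /=; rewrite !tree_history;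
by rewrite /history -map_take take_iota (minn_idPl (leq_addr _ _)).
Qed.

Lemma tree_fun_measurable n (f : bst -> R) :
  measurable_fun [set: T] (fun w => f (tree n w)).
Proof.
move=> _ Y mY; rewrite setTI.
exact: (tree_measurable n (f @^-1` Y)).
Qed.

Lemma size_tree n w : size (external_nodes (tree n w)) = n.+1.
Proof.
elim: n => //= n IH; rewrite /bst_tree/= size_grow//.
  by rewrite -[in LHS]/(bst_tree pick n w) IH.
exact: (pick_external Hpick).
Qed.

Definition cyl n h : set T := [set w | forall k, (k < n)%N -> pick k w = h k].

Definition upd n h v : nat -> node := fun k => if k == n then v else h k.

Lemma cyl_tree n h w : cyl n h w -> tree n w = grow_seq h n.
Proof. exact: eq_grow_seq. Qed.

Lemma cylS n h v : cyl n.+1 (upd n h v) = cyl n h `&` [set w | pick n w = v].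
Proof.
apply/seteqP; split => w /=.
  move=> H; split; last by rewrite H// /upd eqxx.
  by move=> k kn; rewrite H ?ltnS 1?ltnW// /upd ltn_eqF.
move=> [H pv] k; rewrite ltnS leq_eqVlt /upd => /orP[/eqP ->|kn].
  by rewrite eqxx.
by rewrite ltn_eqF// H.
Qed.

Lemma cyl_measurable n h : measurable (cyl n h).
Proof.
elim: n h => [|n IH] h.
  by rewrite (_ : cyl _ _ = setT)//; apply/seteqP; split.
have -> : cyl n.+1 h = cyl n.+1 (upd n h (h n)).
  by congr cyl; apply/funext => k; rewrite /upd; case: eqP => [->|].
rewrite cylS; apply: measurableI => //; exact: (pick_measurable Hpick).
Qed.

Lemma grow_upd n h v : grow_seq (upd n h v) n.+1 = grow (grow_seq h n) v.
Proof.
rewrite /= /upd eqxx; congr grow; apply: eq_grow_seq => k kn.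
by rewrite ltn_eqF.
Qed.

Let pr A : R := fine (P A).

Lemma pr_split n h A : measurable A ->
  pr (cyl n h `&` A) = \sum_(v <- external_nodes (grow_seq h n))
     pr (cyl n.+1 (upd n h v) `&` A).
Proof.
move=> mA; set s := external_nodes _.
have mC v : measurable (cyl n.+1 (upd n h v) `&` A).
  by apply: measurableI => //; exact: cyl_measurable.
have -> : cyl n h `&` A =
    \bigcup_(v in [set` s]) (cyl n.+1 (upd n h v) `&` A).
  apply/seteqP; split => [w [cw Aw]|w [v _]].
    exists (pick n w); last by split => //; rewrite cylS; split.
    by rewrite /= /s -(cyl_tree cw); exact: (pick_external Hpick).
  by rewrite cylS => -[[? _] ?]; split.
rewrite /pr measure_fin_bigcup//; last first.
- by apply/trivIsetP => u v _ _ /eqP uv; apply/seteqP; split => //= w;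
     rewrite !cylS => -[[[_ /= e1] _] [[_ /= e2] _]];
     apply: uv; exact: etrans (esym e1) e2.
- exact: finite_seq.
rewrite -fsbig_seq ?external_nodes_uniq// sum_fine// => v _.
exact: fin_num_measure.
Qed.

Lemma pr_cylS n h v : v \in external_nodes (grow_seq h n) ->
  pr (cyl n.+1 (upd n h v)) =
  pr (cyl n h) / (size (external_nodes (grow_seq h n)))%:R.
Proof.
move=> vt; rewrite /pr cylS (pick_uniform Hpick vt) fineM//.
by apply: fin_num_measure; exact: cyl_measurable.
Qed.

(** Splitting an event according to the next pick reproduces the recursion of
    [growth_mean], because that pick is uniform given the past. *)
Lemma pr_growth r n h (Q : bst -> bool) :
  pr (cyl n h `&` [set w | Q (tree (n + r) w)]) =
  pr (cyl n h) * growth_mean r (grow_seq h n) (fun u => (Q u)%:R).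
Proof.
elim: r n h => [|r IH] n h.
  rewrite addn0 /=; case: (boolP (Q (grow_seq h n))) => q.
    rewrite mulr1; congr pr; apply/seteqP; split => [w []//|w cw].
    by split => //=; rewrite (cyl_tree cw).
  rewrite mulr0 /pr (_ : _ `&` _ = set0) ?measure0//.
  by apply/seteqP; split => // w [cw] /=; rewrite (cyl_tree cw) (negbTE q).
rewrite pr_split; last exact: (tree_measurable _ [set u | Q u]).
rewrite /= mulr_suml mulr_sumr big_seq [RHS]big_seq; apply: eq_bigr => v vt.
by rewrite -addSnnS IH pr_cylS// grow_upd; ring.
Qed.

Lemma pr_growth2 s r n h (Q : bst -> bst -> bool) :
  pr (cyl n h `&` [set w | Q (tree (n + s) w) (tree (n + s + r) w)]) =
  pr (cyl n h) * growth_mean s (grow_seq h n)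
     (fun t => growth_mean r t (fun u => (Q t u)%:R)).
Proof.
elim: s n h => [|s IH] n h.
  rewrite addn0 /= -pr_growth; congr pr; apply/seteqP; split => w [cw] /=;
  by rewrite (cyl_tree cw).
rewrite pr_split; last exact: (two_trees_measurable _ _ Q).
rewrite /= mulr_suml mulr_sumr big_seq [RHS]big_seq; apply: eq_bigr => v vt.
by rewrite -addSnnS IH pr_cylS// grow_upd; ring.
Qed.

Definition deviates s r (c : R) : set T := [set w | exists k,
  c * (s + r).+1%:R < `|(prof (tree (s + r) w) k)%:R
     - (s + r).+1%:R * smear (depths (tree s w)) (kernel s r) k|].

Lemma deviates_measurable s r c : measurable (deviates s r c).
Proof.
exact: (two_trees_measurable s r (fun t u => exists k, c * (s + r).+1%:R <
  `|(prof u k)%:R - (s + r).+1%:R * smear (depths t) (kernel s r) k|)).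
Qed.

(** Markov's inequality for the sum over all levels of the squared deviations
    from the conditional mean; only levels up to [s + r] can contribute. *)
Lemma deviation_prob s r (c : R) : 0 < c ->
  (P (deviates s r c) <= (10 / (s.+1%:R * c ^+ 2))%:E)%E.
Proof.
move=> c0; set n1 := (s + r).+1%:R : R; have n0 : 0 < n1 by rewrite ltr0n.
pose dev t u k : R := (prof u k)%:R - n1 * smear (depths t) (kernel s r) k.
pose N := (s + r).+2.
pose Q t u := [exists k : 'I_N, c * n1 < `|dev t u k|].
have dev0 w k : (s + r < k)%N -> dev (tree s w) (tree (s + r) w) k = 0.
  move=> k_large; rewrite /dev.
  have -> : prof (tree (s + r) w) k = 0%N.
    apply/eqP; rewrite -leqn0 leqNgt; apply/negP => /prof_gt0_size.
    by rewrite size_tree ltnS leqNgt k_large.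
  rewrite /smear big_seq big1 ?mul0r ?mulr0 ?subr0// => x xd.
  rewrite iter_delayE; case: ifP => // xk; apply: kernel_support.
  have : (0 < prof (tree s w) x)%N.
    by rewrite -has_count; move: xd => /mapP[v vt ->]; apply/hasP; exists v.
  by move=> /prof_gt0_size; rewrite size_tree; lia.
have -> : deviates s r c =
    cyl 0 (fun=> [::]) `&` [set w | Q (tree (0 + s) w) (tree (0 + s + r) w)].
  apply/seteqP; split => [w [k ck]|w [_ /existsP[k ck]]]; last by exists k.
  split => //=; apply/existsP.
  case: (leqP k (s + r)) => ks; first by exists (inord k); rewrite inordK ?ltnS ?leqW//.
  by move: ck; rewrite -/n1 -/(dev _ _ k) dev0// normr0 ltNge mulr_ge0 ?ltW.
rewrite -[P _]fineK; last first.
  apply: fin_num_measure; apply: measurableI; first exact: cyl_measurable.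
  exact: (two_trees_measurable s r Q).
rewrite lee_fin -/(pr _) pr_growth2.
have -> : pr (cyl 0 (fun=> [::])) = 1.
  rewrite /pr (_ : cyl _ _ = setT) ?probability_setT//.
  by apply/seteqP; split.
rewrite mul1r -[leRHS](growth_mean_cst s External).
apply: (growth_mean_le (n := 1%N)) => // t; rewrite addn1 => ts.
have := @growth_variance_le R r t s N ts; rewrite -/n1 => V.
have h0 : 0 < (c * n1) ^+ 2 by rewrite exprn_gt0// mulr_gt0.
rewrite -(ler_pM2l h0) -growth_meanZ.
have -> : (c * n1) ^+ 2 * (10 / (s.+1%:R * c ^+ 2)) = 10 * n1 ^+ 2 / s.+1%:R.
  have s0 : s.+1%:R != 0 :> R by rewrite pnatr_eq0.
  by move: (s.+1%:R) s0 => x x0; field; rewrite x0 gt_eqF.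
apply: le_trans V; apply: (growth_mean_le ts) => u _.
rewrite /Q; case: existsP => [[k ck]|_]; last first.
  by rewrite mulr0 sumr_ge0// => k _; exact: sqr_ge0.
rewrite mulr1 (bigD1 k)//= ler_wpDr ?sumr_ge0//; first by move=> i _; exact: sqr_ge0.
rewrite -[leRHS]real_normK ?num_real// lerXn2r ?nnegrE ?mulr_ge0 ?(ltW c0)//.
exact: ltW.
Qed.

End Process.

(** * Derivatives of uniform limits of entire functions *)

Section ComplexExp.
Set Implicit Arguments. Unset Strict Implicit.
Context {R : realType}.
Local Notation C := (R[i]).
Local Notation nm := (@Normc.normc R).
Local Open Scope complex_scope.
Implicit Types (z w : C) (x y : R).

Lemma nm_ge0 z : 0 <= nm z.
Proof. by case: z => a b; rewrite /Normc.normc sqrtr_ge0. Qed.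

Lemma nmB z w : nm (z - w) = nm (w - z).
Proof. by rewrite -normcN opprB. Qed.

Lemma nmC x : nm x%:C = `|x|.
Proof. by rewrite /Normc.normc/= expr0n/= addr0 sqrtr_sqr. Qed.

Lemma nm_nat n : nm n%:R = n%:R.
Proof. by rewrite -(rmorph_nat (real_complex R)) nmC normr_nat. Qed.

Lemma nmX z n : nm (z ^+ n) = nm z ^+ n.
Proof. by elim: n => [|n IH]; rewrite ?expr0 ?Normc.normc1// !exprS Normc.normcM IH. Qed.

Lemma nmE z : `|z| = (nm z)%:C.
Proof. by case: z => a b; rewrite normc_def. Qed.

Lemma nm_Re_Im z : nm z <= `|complex.Re z| + `|complex.Im z|.
Proof.
case: z => a b /=; rewrite -[leRHS]ger0_norm ?addr_ge0// -sqrtr_sqr ler_wsqrtr//.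
rewrite sqrrD !real_normK ?num_real// lerD2r lerDl.
by rewrite mulrn_wge0// mulr_ge0.
Qed.

Lemma Re_le_nm z : `|complex.Re z| <= nm z.
Proof.
by case: z => a b /=; rewrite -sqrtr_sqr ler_wsqrtr// lerDl sqr_ge0.
Qed.

Lemma Im_le_nm z : `|complex.Im z| <= nm z.
Proof.
by case: z => a b /=; rewrite -sqrtr_sqr ler_wsqrtr// lerDr sqr_ge0.
Qed.

Lemma nm_sum (I : Type) (s : seq I) (F : I -> C) :
  nm (\sum_(i <- s) F i) <= \sum_(i <- s) nm (F i).
Proof.
elim: s => [|i s IH]; first by rewrite !big_nil Normc.normc0.
by rewrite !big_cons (le_trans (le_normcD _ _))// lerD2l.
Qed.

Lemma cexpD z w : cexp (z + w) = cexp z * cexp w.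
Proof.
case: z w => [a b] [c d]; rewrite /cexp /= expRD cosD sinD.
by apply/eqP; rewrite eq_complex/=; apply/andP; split; apply/eqP; ring.
Qed.

Lemma cexp0 : cexp 0 = 1 :> C.
Proof. by rewrite /cexp/= expR0 cos0 sin0 !mul1r. Qed.

Lemma cexpC x : cexp x%:C = (expR x)%:C.
Proof. by rewrite /cexp/= cos0 sin0 mulr1 mulr0. Qed.

Lemma nm_cexp z : nm (cexp z) = expR (complex.Re z).
Proof.
case: z => a b; rewrite /cexp/= !exprMn -mulrDr cos2Dsin2 mulr1 sqrtr_sqr.
by rewrite ger0_norm// expR_ge0.
Qed.

Lemma nm_cexp_le z : nm (cexp z) <= expR (nm z).
Proof.
by rewrite nm_cexp ler_expR (le_trans (ler_norm _))// Re_le_nm.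
Qed.

Lemma cexpMn z n : cexp (z *+ n) = cexp z ^+ n.
Proof. by elim: n => [|n IH]; rewrite ?cexp0// mulrS cexpD IH exprS. Qed.

Lemma norm_sin_le x : `|sin x| <= `|x|.
Proof.
wlog x0 : x / 0 <= x.
  move=> h; case: (leP 0 x) => [/h//|/ltW x0].
  by rewrite -normrN -sinN -[leRHS]normrN h// oppr_ge0.
have [c _] := @MVT_segment R sin cos 0 x x0 (fun y _ => is_derive_sin y)
   (continuous_subspaceT (@continuous_sin R)).
rewrite sin0 !subr0 => ->; rewrite normrM ler_piMl//.
exact: cos_max.
Qed.

Lemma cos_lower x : 1 - x ^+ 2 / 2 <= cos x.
Proof.
have -> : x = (x / 2) *+ 2 by rewrite -mulr_natr; field.
rewrite cos_mulr2n cos2sin2; have := norm_sin_le (x / 2).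
rewrite -ler_sqr ?nnegrE// !real_normK ?num_real//.
have -> : (x / 2) *+ 2 = x by rewrite -mulr_natr; field.
rewrite expr_div_n; lra.
Qed.

Lemma sin_close x : `|x| <= 1 -> `|sin x - x| <= x ^+ 2.
Proof.
wlog x0 : x / 0 <= x.
  move=> h; case: (leP 0 x) => [/h//|/ltW x0] x1.
  have := h (- x); rewrite oppr_ge0 x0 normrN x1 sinN sqrrN.
  by rewrite -opprD normrN; exact.
rewrite (ger0_norm x0) => x1.
have [c] := @MVT_segment R sin cos 0 x x0 (fun y _ => is_derive_sin y)
   (continuous_subspaceT (@continuous_sin R)).
rewrite in_itv/= sin0 !subr0 => /andP[c0 cx] ->.
have -> : cos c * x - x = - ((1 - cos c) * x) by ring.
have h1 := cos_lower c; have h2 := cos_le1 c.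
rewrite normrN ger0_norm ?mulr_ge0 ?subr_ge0// expr2 ler_wpM2r//.
have : c * c <= 1 * x by rewrite ler_pM//; lra.
by rewrite -expr2; have := sqr_ge0 c; lra.
Qed.

Lemma expR_close x : `|x| <= 1 -> `|expR x - 1 - x| <= 2 * x ^+ 2.
Proof.
rewrite ler_norml => /andP[x1 x2].
have h1 := expR_ge1Dx x; rewrite ger0_norm; last by lra.
have [x0|x0] := leP 0 x.
  have := expR_ge1Dx (- (x / 2)); set e := expR (- (x / 2)) => h.
  have e2 : e ^+ 2 * expR x = 1.
    by rewrite /e -expRM_natl -expRD -expR0; congr expR; field.
  have e0 : 0 < expR x := expR_gt0 x.
  have h3 : (1 - x / 2) ^+ 2 <= e ^+ 2 by rewrite ler_sqr ?nnegrE ?expR_ge0//; lra.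
  have h4 : (1 - x / 2) ^+ 2 * expR x <= 1 by rewrite -[leRHS]e2 ler_wpM2r// ltW.
  have h5 : 0 < (1 - x / 2) ^+ 2 by rewrite exprn_gt0//; lra.
  rewrite -(ler_pM2l h5).
  have h7 : 0 <= x ^+ 2 * (1 - x) * (5 - 2 * x).
    by rewrite !mulr_ge0 ?sqr_ge0//; lra.
  lra.
have := expRN_bounds (p := - x); rewrite opprK sqrrN => /(_ _)/andP[|_]; first by lra.
by have := sqr_ge0 x; lra.
Qed.

Lemma cexp_close w : nm w <= 1 -> nm (cexp w - 1 - w) <= 11 * nm w ^+ 2.
Proof.
move=> w1; set r := nm w in w1 *; have r0 : 0 <= r := nm_ge0 w.
have xr := Re_le_nm w; have yr := Im_le_nm w; rewrite -/r in xr yr.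
apply: le_trans (nm_Re_Im _) _.
move: r w1 r0 xr yr; case: w => x y r w1 r0 /= xr yr.
have x1 : `|x| <= 1 by lra.
have y1 : `|y| <= 1 by lra.
have h1 := expR_close x1; have h2 := sin_close y1.
have h3 := cos_lower y; have h4 := cos_le1 y.
have e4 : expR x <= 4.
  have : x ^+ 2 <= 1 by rewrite -[leLHS]real_normK ?num_real// exprn_ile1.
  by move: h1 x1; rewrite !ler_norml; lra.
have e0 := expR_gt0 x.
have xx : x ^+ 2 <= r ^+ 2 by rewrite -[leLHS]real_normK ?num_real// ler_sqr ?nnegrE.
have yy : y ^+ 2 <= r ^+ 2 by rewrite -[leLHS]real_normK ?num_real// ler_sqr ?nnegrE.
have x3 : `|expR x - 1| <= 3 * r.
  have -> : expR x - 1 = (expR x - 1 - x) + x by ring.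
  apply: le_trans (ler_normD _ _) _.
  have : r ^+ 2 <= r by rewrite expr2 ler_piMr.
  lra.
have -> : expR x * cos y - 1 - x = (expR x - 1 - x) - expR x * (1 - cos y) by ring.
have -> : expR x * sin y - 0 - y = expR x * (sin y - y) + (expR x - 1) * y by ring.
have t1 : `|expR x * (1 - cos y)| <= 4 * (r ^+ 2 / 2).
  rewrite ger0_norm ?mulr_ge0 ?(ltW e0) ?subr_ge0//.
  by rewrite ler_pM ?(ltW e0) ?subr_ge0//; lra.
have t2 : `|expR x * (sin y - y)| <= 4 * r ^+ 2.
  by rewrite normrM (gtr0_norm e0) ler_pM ?(ltW e0)//; lra.
have t3 : `|(expR x - 1) * y| <= 3 * r * r by rewrite normrM ler_pM.
have := ler_normB (expR x - 1 - x) (expR x * (1 - cos y)).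
have := ler_normD (expR x * (sin y - y)) ((expR x - 1) * y).
have -> : 11 * r ^+ 2 = 2 * r ^+ 2 + 2 * r ^+ 2 + 4 * r ^+ 2 + 3 * r * r by ring.
lra.
Qed.

(** [a ^+ N - b ^+ N] has the factor [a - b], of order [N ^- 2], and a cofactor
    of [N] bounded terms. *)
Lemma cexp_pow_close (M : R) n z : nm z <= M -> M <= n.+1%:R ->
  nm (cexp z - (1 + z / n.+1%:R) ^+ n.+1) <= 11 * M ^+ 2 * expR M / n.+1%:R.
Proof.
move=> zM Mn; set N := n.+1%:R : R; have N0 : 0 < N by rewrite ltr0n.
have M0 : 0 <= M := le_trans (nm_ge0 z) zM.
pose u := z / n.+1%:R.
have uE : nm u = nm z / N by rewrite Normc.normcM Normc.normcV nm_nat.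
have uM : nm u <= M / N by rewrite uE ler_wpM2r// invr_ge0 ltW.
have MN1 : M / N <= 1 by rewrite ler_pdivrMr// mul1r.
have -> : cexp z = cexp u ^+ n.+1.
  by rewrite -cexpMn -mulr_natr divfK// pnatr_eq0.
rewrite subrXX Normc.normcM.
have q1 : nm (cexp u) <= expR (M / N).
  by rewrite (le_trans (nm_cexp_le _))// ler_expR.
have q2 : nm (1 + u) <= expR (M / N).
  rewrite (le_trans (le_normcD _ _))// Normc.normc1.
  by rewrite (le_trans _ (expR_ge1Dx _))// lerD2l.
have h1 : nm (cexp u - (1 + u)) <= 11 * (M / N) ^+ 2.
  rewrite opprD addrA (le_trans (cexp_close _))//; first exact: le_trans MN1.
  by rewrite ler_wpM2l// lerXn2r ?nnegrE ?nm_ge0// divr_ge0// ltW.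
have h2 : nm (\sum_(i < n.+1) cexp u ^+ (n.+1.-1 - i) * (1 + u) ^+ i) <= N * expR M.
  apply: le_trans (nm_sum _ _) _; rewrite sum_ord_const; apply: ler_sum => i _.
  rewrite Normc.normcM !nmX.
  apply: (@le_trans _ _ (expR (M / N) ^+ (n.+1.-1 - i) * expR (M / N) ^+ i)).
    by rewrite ler_pM ?exprn_ge0 ?nm_ge0// lerXn2r ?nnegrE ?nm_ge0 ?expR_ge0.
  rewrite -exprD subnK -?expRM_natl ?leq_ord// ler_expR /=.
  by rewrite mulrA ler_pdivrMr// mulrC ler_wpM2l// ler_nat.
apply: le_trans (ler_pM _ _ h1 h2) _; rewrite ?nm_ge0//.
by rewrite le_eqVlt; apply/orP; left; apply/eqP; field; lra.
Qed.

End ComplexExp.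

Section PolynomialLimits.
Set Implicit Arguments. Unset Strict Implicit.
Context {R : realType}.
Local Notation C := (R[i]).
Local Notation nm := (@Normc.normc R).
Local Open Scope complex_scope.
Variable rho : R.
Hypothesis rho0 : 0 <= rho.
Implicit Types (f g : C -> C) (a b : C) (p q : {poly C}).

(** A substitute for analyticity on the disc of radius [rho]: [a] stands for the
    derivative of [f] at the origin. The class is stable under sums, products
    and exponentials, hence contains every [biggins pick n w], and a Cauchy
    estimate for it reduces to one for polynomials. *)
Definition poly_limit f a : Prop := forall e : R, 0 < e ->
  exists2 p : {poly C}, (forall z, nm z <= rho -> nm (p.[z] - f z) <= e)
                      & nm (p`_1 - a) <= e.

Lemma poly_limit_bounded f a : poly_limit f a ->
  exists2 B : R, 1 <= B & forall z, nm z <= rho -> nm (f z) <= B.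
Proof.
move=> /(_ 1 ltr01)[p pf _].
pose S := \sum_(i < size p) nm p`_i * rho ^+ i.
have S0 : 0 <= S by apply: sumr_ge0 => i _; rewrite mulr_ge0 ?nm_ge0 ?exprn_ge0.
exists (1 + S) => [|z zr]; first by rewrite lerDl.
have -> : f z = p.[z] - (p.[z] - f z) by rewrite opprB addrC subrK.
rewrite (le_trans (le_normcD _ _))// normcN addrC lerD ?pf//.
rewrite horner_coef (le_trans (nm_sum _ _))//; apply: ler_sum => i _.
rewrite Normc.normcM nmX ler_wpM2l ?nm_ge0// lerXn2r ?nnegrE ?nm_ge0//.
Qed.

Lemma poly_limit_cst c : poly_limit (fun=> c) 0.
Proof.
move=> e e0; exists c%:P => [z _|].
  by rewrite hornerC subrr Normc.normc0 ltW.
have -> : (c%:P)`_1 = 0 by rewrite coefC.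
by rewrite subrr Normc.normc0 ltW.
Qed.

Lemma poly_limit_id : poly_limit id 1.
Proof.
move=> e e0; exists 'X => [z _|].
  by rewrite hornerX subrr Normc.normc0 ltW.
have -> : ('X : {poly C})`_1 = 1 by rewrite coefX.
by rewrite subrr Normc.normc0 ltW.
Qed.

Lemma poly_limit_closed f a : (forall e : R, 0 < e -> exists2 gb : (C -> C) * C,
    poly_limit gb.1 gb.2 &
    (forall z, nm z <= rho -> nm (gb.1 z - f z) <= e) /\ nm (gb.2 - a) <= e) ->
  poly_limit f a.
Proof.
move=> H e e0; have h0 : 0 < e / 2 by lra.
have [[g b]/= /(_ _ h0)[p pg pb] [gf ba]] := H _ h0.
exists p => [z zr|].
  have -> : p.[z] - f z = (p.[z] - g z) + (g z - f z) by ring.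
  by rewrite (le_trans (le_normcD _ _))//; have := pg z zr; have := gf z zr; lra.
have -> : p`_1 - a = (p`_1 - b) + (b - a) by ring.
by rewrite (le_trans (le_normcD _ _))//; lra.
Qed.

Lemma poly_limitD f g a b : poly_limit f a -> poly_limit g b ->
  poly_limit (fun z => f z + g z) (a + b).
Proof.
move=> Hf Hg e e0; have h0 : 0 < e / 2 by lra.
have [p pf pa] := Hf _ h0; have [q qg qb] := Hg _ h0.
exists (p + q) => [z zr|].
  rewrite hornerD (_ : _ - _ = (p.[z] - f z) + (q.[z] - g z)); last by ring.
  by rewrite (le_trans (le_normcD _ _))//; have := pf z zr; have := qg z zr; lra.
rewrite coefD (_ : _ - _ = (p`_1 - a) + (q`_1 - b)); last by ring.
by rewrite (le_trans (le_normcD _ _))//; lra.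
Qed.

(** The bound [e <= 1] makes the estimate linear in [e]. *)
Lemma nm_prod_close (B e : R) (x y u v : C) : 0 <= e -> e <= 1 -> 0 <= B ->
  nm y <= B -> nm v <= B ->
  nm (x - y) <= e -> nm (u - v) <= e -> nm (x * u - y * v) <= e * (2 * B + 1).
Proof.
move=> e0 e1 B0 yB vB xy uv.
have -> : x * u - y * v = (x - y) * u + y * (u - v) by ring.
rewrite (le_trans (le_normcD _ _))// !Normc.normcM.
have uB : nm u <= B + 1.
  by rewrite -(subrK v u) (le_trans (le_normcD _ _))//; lra.
have h1 : nm (x - y) * nm u <= e * (B + 1) by rewrite ler_pM ?nm_ge0.
have h2 : nm y * nm (u - v) <= B * e by rewrite ler_pM ?nm_ge0.
lra.
Qed.

Lemma poly_limitM f g a b : poly_limit f a -> poly_limit g b ->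
  poly_limit (fun z => f z * g z) (a * g 0 + f 0 * b).
Proof.
move=> Hf Hg e e0.
have [B1 B11 fB] := poly_limit_bounded Hf.
have [B2 B21 gB] := poly_limit_bounded Hg.
pose B := B1 + B2 + nm a + nm b.
have na := nm_ge0 a; have nb := nm_ge0 b.
pose s := e / (4 * B + 2 + e).
have d0 : 0 < 4 * B + 2 + e by rewrite /B; lra.
have s0 : 0 < s by rewrite divr_gt0.
have s1 : s <= 1 by rewrite ler_pdivrMr// mul1r /B; lra.
have sB : s * (4 * B + 2) <= e.
  have -> : s * (4 * B + 2) = e - s * e by rewrite /s; field; lra.
  by rewrite gerBl mulr_ge0// ltW.
have B0 : 0 <= B by rewrite /B; lra.
have [p pf pa] := Hf _ s0; have [q qg qb] := Hg _ s0.
have z0 : nm 0 <= rho by rewrite Normc.normc0.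
have sB2 : s * (2 * B + 1) <= e.
  have : 0 <= s * (2 * B + 1) by rewrite mulr_ge0//; lra.
  lra.
exists (p * q) => [z zr|].
  have h1 := fB z zr; have h2 := gB z zr.
  rewrite hornerM (le_trans (nm_prod_close (B := B) (ltW s0) _ _ _ _ (pf z zr) (qg z zr)))//.
    by rewrite /B; lra.
  by rewrite /B; lra.
rewrite coefM 2!big_ord_recl big_ord0/= /bump/= addr0 -!horner_coef0.
have -> : p.[0] * q`_1 + p`_1 * q.[0] - (a * g 0 + f 0 * b) =
   (p`_1 * q.[0] - a * g 0) + (p.[0] * q`_1 - f 0 * b) by ring.
have h1 := fB 0 z0; have h2 := gB 0 z0.
have t1 : nm (p`_1 * q.[0] - a * g 0) <= s * (2 * B + 1).
  by apply: nm_prod_close => //; rewrite ?(ltW s0) ?qg// /B; lra.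
have t2 : nm (p.[0] * q`_1 - f 0 * b) <= s * (2 * B + 1).
  by apply: nm_prod_close => //; rewrite ?(ltW s0) ?pf// /B; lra.
rewrite (le_trans (le_normcD _ _))//; lra.
Qed.

Lemma eq_poly_limit f g a b : f =1 g -> a = b -> poly_limit f a -> poly_limit g b.
Proof. by move=> /funext -> ->. Qed.

Lemma poly_limitX f a n : poly_limit f a ->
  poly_limit (fun z => f z ^+ n.+1) (n.+1%:R * f 0 ^+ n * a).
Proof.
move=> Hf; elim: n => [|n IH].
  by apply: eq_poly_limit Hf => [z|]; rewrite ?expr1// expr0 !mul1r.
apply: eq_poly_limit (poly_limitM Hf IH) => [z|]; first by rewrite [RHS]exprS.
by rewrite [in RHS]exprS -[n.+2%:R]natr1; rewrite exprS; ring.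
Qed.

Lemma poly_limit_sum (I : Type) (s : seq I) (F : I -> C -> C) (a : I -> C) :
  (forall i, poly_limit (F i) (a i)) ->
  poly_limit (fun z => \sum_(i <- s) F i z) (\sum_(i <- s) a i).
Proof.
move=> H; elim: s => [|i s IH].
  apply: eq_poly_limit (poly_limit_cst 0) => [z|]; by rewrite big_nil.
by apply: eq_poly_limit (poly_limitD (H i) IH) => [z|]; rewrite big_cons.
Qed.

(** The exponential of [f] is the limit of the powers [(1 + f / N) ^+ N]. *)
Lemma poly_limit_cexp f a : poly_limit f a ->
  poly_limit (fun z => cexp (f z)) (cexp (f 0) * a).
Proof.
move=> Hf; have [M M1 fM] := poly_limit_bounded Hf.
apply: poly_limit_closed => e e0.
have na := nm_ge0 a.
pose K := (11 * M ^+ 2 * expR M + M * expR M) * (1 + nm a).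
have eM := expR_gt0 M.
have K1 : 0 <= M * expR M by rewrite mulr_ge0 ?(ltW eM)//; lra.
have K2 : 0 <= 11 * M ^+ 2 * expR M by rewrite mulr_ge0 ?(ltW eM)// mulr_ge0// sqr_ge0.
have K0 : 0 <= K by rewrite mulr_ge0 ?addr_ge0.
pose n := maxn (Num.truncn (K / e)) (Num.truncn M).
have nK : K / e <= n.+1%:R.
  rewrite (le_trans (ltW (truncnS_gt _)))// ler_nat.
  by rewrite ltnS leq_maxl.
have nM : M <= n.+1%:R.
  rewrite (le_trans (ltW (truncnS_gt _)))// ler_nat.
  by rewrite ltnS leq_maxr.
have n0 : 0 < n.+1%:R :> R by rewrite ltr0n.
have nc0 : n.+1%:R != 0 :> C by rewrite pnatr_eq0.
have Kn : K / n.+1%:R <= e.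
  by rewrite ler_pdivrMr// mulrC -ler_pdivrMr.
have z0 : nm 0 <= rho by rewrite Normc.normc0.
pose g z := 1 + n.+1%:R^-1 * f z.
have Hg : poly_limit g (n.+1%:R^-1 * a).
  apply: eq_poly_limit (poly_limitD (poly_limit_cst 1)
     (poly_limitM (poly_limit_cst n.+1%:R^-1) Hf)) => //=.
  by rewrite mul0r !add0r.
exists ((fun z => g z ^+ n.+1), n.+1%:R * g 0 ^+ n * (n.+1%:R^-1 * a)) => /=.
  exact: poly_limitX.
have close z : nm z <= rho ->
    nm (g z ^+ n.+1 - cexp (f z)) <= 11 * M ^+ 2 * expR M / n.+1%:R.
  by move=> /fM zM; rewrite nmB /g mulrC; exact: cexp_pow_close.
split=> [z zr|].
  apply: le_trans (close z zr) (le_trans _ Kn).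
  rewrite ler_wpM2r ?invr_ge0 ?(ltW n0)// /K mulrDr mulr1.
  have := mulr_ge0 (addr_ge0 K2 K1) na; lra.
have -> : n.+1%:R * g 0 ^+ n * (n.+1%:R^-1 * a) - cexp (f 0) * a =
    ((g 0 ^+ n.+1 - cexp (f 0)) - g 0 ^+ n * (n.+1%:R^-1 * f 0)) * a.
  have -> : g 0 ^+ n.+1 = g 0 ^+ n + g 0 ^+ n * (n.+1%:R^-1 * f 0).
    by rewrite exprSr {2}/g mulrDr mulr1.
  by field.
have nminv : nm (n.+1%:R^-1 : C) = n.+1%:R^-1 by rewrite Normc.normcV nm_nat.
have f0M : nm (n.+1%:R^-1 * f 0) <= M / n.+1%:R.
  by rewrite Normc.normcM nminv mulrC ler_wpM2r ?invr_ge0 ?(ltW n0)// fM.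
have g0n : nm (g 0 ^+ n) <= expR M.
  rewrite nmX; apply: (@le_trans _ _ (expR (M / n.+1%:R) ^+ n)).
    rewrite lerXn2r ?nnegrE ?nm_ge0 ?expR_ge0// (le_trans (le_normcD _ _))//.
    rewrite Normc.normc1 (le_trans _ (expR_ge1Dx _))// lerD2l//.
  rewrite -expRM_natl ler_expR mulrA ler_pdivrMr// mulrC ler_wpM2l ?ler_nat//.
  by lra.
have t : nm (g 0 ^+ n * (n.+1%:R^-1 * f 0)) <= expR M * (M / n.+1%:R).
  by rewrite Normc.normcM ler_pM ?nm_ge0.
rewrite Normc.normcM; apply: le_trans Kn.
have -> : K / n.+1%:R = (11 * M ^+ 2 * expR M / n.+1%:R + expR M * (M / n.+1%:R))
    * (1 + nm a) by rewrite /K; ring.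
rewrite ler_pM ?nm_ge0//; last by lra.
rewrite (le_trans (le_normcD _ _))// normcN lerD//.
exact: close.
Qed.

End PolynomialLimits.

Section CauchyEstimate.
Set Implicit Arguments. Unset Strict Implicit.
Context {R : realType}.
Local Notation C := (R[i]).
Local Notation nm := (@Normc.normc R).
Local Open Scope complex_scope.
Implicit Types (p q : {poly C}) (t rho eta : R).

Definition circ rho t : C := rho%:C * cexp (0 +i* t).

Lemma nm_circ rho t : 0 <= rho -> nm (circ rho t) = rho.
Proof.
by move=> r0; rewrite Normc.normcM nmC nm_cexp/= expR0 mulr1 ger0_norm.
Qed.

(** Averaging [p.[z] / z] over sufficiently many equidistant points of the
    circle extracts the coefficient of degree one exactly. *)
Lemma coef1_le p rho eta : 0 < rho ->
  (forall t, 0 <= t <= pi *+ 2 -> nm p.[circ rho t] <= eta) ->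
  nm p`_1 * rho <= eta.
Proof.
move=> r0 pe; pose N := (size p).+2.
have N0 : 0 < N%:R :> R by rewrite ltr0n.
pose arg k : R := (pi *+ 2) * k%:R / N%:R.
pose w : C := cexp (0 +i* (arg 1%N)).
have wX k : w ^+ k = cexp (0 +i* arg k).
  rewrite -cexpMn; congr cexp; rewrite /arg.
  elim: k => [|k IH]; first by rewrite mulr0n mulr0 mul0r.
  rewrite mulrS IH -[k.+1%:R]natr1; apply/eqP; rewrite eq_complex/= addr0 eqxx/=.
  by apply/eqP; ring.
have wN : w ^+ N = 1.
  rewrite wX /arg mulfK ?gt_eqF// /cexp/= expR0 cos2pi sin2pi !mul1r.
  by [].
have w1 k : (0 < k < N)%N -> w ^+ k != 1.
  move=> /andP[k0 kN]; rewrite wX; apply/negP => /eqP/(congr1 (@complex.Re R)).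
  rewrite /cexp/= expR0 mul1r.
  have -> : arg k = (pi * k%:R / N%:R) *+ 2.
    by rewrite /arg !mulrnAl.
  rewrite cos_mulr2n cos2sin2.
  have : 0 < sin (pi * k%:R / N%:R :> R).
    apply: sin_gt0_pi; rewrite divr_gt0 ?mulr_gt0 ?pi_gt0 ?ltr0n//=.
    by rewrite ltr_pdivrMr// ltr_pM2l ?pi_gt0// ltr_nat.
  move: (sin _) => u u0 e; have : 0 < u ^+ 2 by rewrite exprn_gt0.
  lra.
have sumw k : (0 < k < N)%N -> \sum_(j < N) (w ^+ k) ^+ j = 0.
  move=> kN; have := subrX1 (w ^+ k) N.
  rewrite -exprM mulnC exprM wN expr1n subrr => /esym/eqP.
  by rewrite mulf_eq0 subr_eq0 (negbTE (w1 _ kN))/= => /eqP.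
have E : \sum_(j < N) p.[rho%:C * w ^+ j] * (w ^+ j) ^+ N.-1 =
    N%:R * (p`_1 * rho%:C).
  under eq_bigr => j _.
    rewrite (@horner_coef_wide _ N) ?leqW// mulr_suml.
    under eq_bigr => i _.
      rewrite exprMn mulrA -mulrA -exprD -exprM mulnC exprM.
      over.
    over.
  rewrite exchange_big/=; under eq_bigr do rewrite -mulr_sumr.
  rewrite (bigD1 (Ordinal (isT : (1 < N)%N)))//= [X in _ + X]big1 ?addr0.
    rewrite -[(1 + _)%N]/N wN; under eq_bigr do rewrite expr1n.
    by rewrite sumr_const card_ord expr1 mulrC.
  move=> [[|[|i]] iN]//= _.
    by rewrite sumw ?mulr0// !ltnS leqnn.
  have -> : (i.+2 + (size p).+1)%N = (i.+1 + N)%N by rewrite /N !addSn !addnS.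
  by rewrite exprD wN mulr1 sumw ?mulr0//= ltnW.
have : nm (N%:R * (p`_1 * rho%:C)) <= N%:R * eta.
  rewrite -E (le_trans (nm_sum _ _))// sum_ord_const; apply: ler_sum => j _.
  rewrite Normc.normcM nmX wX nm_cexp/= expR0 expr1n mulr1; apply: pe.
  have pi2 : 0 <= pi *+ 2 :> R by rewrite mulrn_wge0 ?pi_ge0.
  apply/andP; split; first by rewrite divr_ge0 ?(ltW N0)// mulr_ge0.
  by rewrite ler_pdivrMr// ler_wpM2l// ler_nat ltnW.
by rewrite !Normc.normcM nm_nat nmC (gtr0_norm r0) ler_pM2l.
Qed.

(** Uniform convergence on one small circle controls the derivatives at its
    centre, up to the error of the linear approximation of the limit on that
    circle. *)
Lemma deriv_close (f F : C -> C) (a c : C) rho eps : 0 < rho -> 0 < eps ->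
  poly_limit rho f a ->
  (forall t, 0 <= t <= pi *+ 2 ->
     nm (F (circ rho t) - F 0 - c * circ rho t) <= eps * rho) ->
  (forall t, 0 <= t <= pi *+ 2 ->
     nm (f (circ rho t) - F (circ rho t)) <= eps * rho) ->
  nm (a - c) <= 4 * eps.
Proof.
move=> r0 e0 Hf Flin fF.
have m0 : 0 < Num.min eps (eps * rho) by rewrite lt_min e0 mulr_gt0.
have [p pf pa] := Hf _ m0; move: pa; rewrite le_min => /andP[pa _].
pose q := p - (F 0)%:P - c *: 'X.
have qe t : 0 <= t <= pi *+ 2 -> nm q.[circ rho t] <= 3 * eps * rho.
  move=> t0; set z := circ rho t.
  have -> : q.[z] = (p.[z] - f z) + (f z - F z) + (F z - F 0 - c * z).
    rewrite /q !hornerD !hornerN hornerC hornerZ hornerX.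
    by move: (p.[z]) (f z) (F z) (F 0) => ? ? ? ?; ring.
  have h1 := Flin t t0; have h2 := fF t t0.
  have h3 : nm (p.[z] - f z) <= eps * rho.
    have /pf : nm z <= rho by rewrite nm_circ// ltW.
    by rewrite le_min => /andP[].
  rewrite (le_trans (le_normcD _ _))//; have := le_normcD (p.[z] - f z) (f z - F z).
  rewrite -/z in h1 h2; lra.
have := coef1_le r0 qe; rewrite ler_pM2r//.
have -> : q`_1 = p`_1 - c by rewrite /q !coefE/= subr0 mulr1.
move=> h; have -> : a - c = (p`_1 - c) - (p`_1 - a) by ring.
rewrite (le_trans (le_normcD _ _))// normcN; lra.
Qed.

End CauchyEstimate.

Section BigginsDerivative.
Set Implicit Arguments. Unset Strict Implicit.
Context {R : realType}.
Local Notation C := (R[i]).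
Local Notation nm := (@Normc.normc R).
Local Open Scope complex_scope.

Lemma nbhs0_nm (A : set C^o) : nbhs (0 : C^o) A ->
  exists2 e : R, 0 < e & forall z, nm z < e -> A z.
Proof.
move=> /nbhs_ballP[e /= e0 eA]; move: (e0); rewrite ltcE/= => /andP[/eqP ei er].
exists (complex.Re e) => // z ze; apply: eA.
rewrite -ball_normE /ball_/= sub0r normrN nmE ltcE/= ei eqxx/=.
exact: ze.
Qed.

Lemma circ_compact (rho : R) :
  compact ((circ rho : R -> C^o) @` `[0, pi *+ 2]).
Proof.
apply: continuous_compact; last exact: segment_compact.
apply: continuous_subspaceT => t; apply/cvgrPdist_lt => e e0.
move: (e0); rewrite ltcE/= => /andP[/eqP ei er].
pose d := complex.Re e / (2 * (`|rho| + 1)).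
have r1 : 0 < `|rho| + 1 by rewrite ltr_wpDl.
have d0 : 0 < d by rewrite divr_gt0 ?mulr_gt0.
have hc : \forall u \near t, `|cos t - cos u| < d.
  by have /cvgrPdist_lt := @continuous_cos R t; apply.
have hs : \forall u \near t, `|sin t - sin u| < d.
  by have /cvgrPdist_lt := @continuous_sin R t; apply.
near=> u; suff h : nm (circ rho t - circ rho u) < complex.Re e.
  by rewrite nmE ltcE; apply/andP; split; [rewrite /= ei|].
have c1 : `|cos t - cos u| < d by near: u.
have s1 : `|sin t - sin u| < d by near: u.
have -> : circ rho t - circ rho u =
    rho%:C * ((cos t - cos u) +i* (sin t - sin u)).
  rewrite /circ -mulrBr; congr (_ * _); rewrite /cexp/= expR0 !mul1r.
  by [].
rewrite Normc.normcM nmC.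
apply: (@le_lt_trans _ _ (`|rho| * (d + d))).
  by rewrite ler_wpM2l// (le_trans (nm_Re_Im _))//= lerD// ltW.
have -> : complex.Re e = (`|rho| + 1) * (d + d).
  by rewrite /d; field; rewrite gt_eqF.
by rewrite ltr_pM2r ?addr_gt0// ltrDl ltr01.
Unshelve. all: by end_near.
Qed.

Lemma derive1_nm (F : C^o -> C^o) : derivable F 0 1 ->
  forall e : R, 0 < e -> exists2 d : R, 0 < d & forall z, nm z < d ->
    nm (F z - F 0 - derive1 F 0 * z) <= e * nm z.
Proof.
move=> dF e e0.
have H : h^-1 *: (F (h + 0) - F 0) @[h --> (0 : C^o)^'] --> derive1 F 0.
  have := dF; rewrite /derivable /derive1.
  suff -> : (fun h : C => h^-1 *: ((F \o shift (0 : C^o)) (h *: (1 : C^o)) - F 0)) =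
    (fun h : C => h^-1 *: (F (h + 0) - F 0)) by [].
  by apply/funext => h; rewrite /= /GRing.scale/= mulr1.
have e0' : 0 < e%:C by rewrite ltcR.
move/cvgrPdist_lt : H => /(_ _ e0').
move=> /(@nbhs0_nm (fun h => h != 0 -> _))[d d0 dP].
exists d => // z zd.
have [->|z0] := eqVneq z 0.
  by rewrite subrr sub0r mulr0 oppr0 !Normc.normc0 mulr0.
have := dP z zd z0; rewrite nmE ltcR addr0 => h.
have -> : F z - F 0 - derive1 F 0 * z =
    - ((derive1 F 0 - z^-1 *: (F z - F 0)) * z).
  by rewrite /GRing.scale/=; field.
by rewrite normcN Normc.normcM ler_wpM2r ?nm_ge0// ltW.
Qed.

Lemma uniform_nm (f : nat -> C^o -> C^o) (F : C^o -> C^o) (A : set C^o) :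
  {uniform A, f @ \oo --> F} -> forall e : R, 0 < e ->
  \forall n \near \oo, forall z, A z -> nm (f n z - F z) <= e.
Proof.
move=> H e e0; have e0' : 0 < e%:C by rewrite ltcR.
pose E := [set xy : C^o * C^o | ball xy.1 e%:C xy.2].
have := H [set h | forall y, A y -> E (F y, h y)].
have nb : nbhs (F : {uniform` A -> C^o}) [set h | forall y, A y -> E (F y, h y)].
  apply/uniform_nbhs; exists E; split => //.
  exact: (@entourage_ball _ C^o (PosNum e0')).
move=> /(_ nb) hn; suff : [set n | forall y, A y -> E (F y, f n y)] `<=`
    [set n | forall z, A z -> nm (f n z - F z) <= e].
  by move=> /filterS; apply; exact: hn.
move=> n h z Az; have := h z Az.
by rewrite /E/= -ball_normE /ball_/= nmE ltcR nmB => /ltW.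
Qed.

(** The derivative of [W_n] at the origin; for positive [n], [expR (- ln n)]
    is [n^-1]. *)
Definition biggins_deriv n (t : bst) : R :=
  expR (- ln n%:R) * (\sum_(x <- depths t) x%:R
    - 2 * ln n%:R * (size (external_nodes t))%:R).

Lemma biggins_poly_limit {d : measure_display} {T : measurableType d}
    (pick : nat -> T -> node) n w (rho : R) : 0 <= rho ->
  poly_limit rho (biggins pick n w) (biggins_deriv n (bst_tree pick n w))%:C.
Proof.
move=> r0; set t := bst_tree pick n w; pose L : R := ln n%:R.
have He : poly_limit rho (fun z : C => cexp z) 1.
  by apply: eq_poly_limit (poly_limit_cexp r0 (poly_limit_id rho)) => //=;
     rewrite cexp0 mulr1.
have H1 : poly_limit rho (fun z : C => - (2 * cexp z - 1) * L%:C) (- 2 * L%:C).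
  have := poly_limitD (poly_limit_cst rho L%:C)
    (poly_limitM r0 (poly_limit_cst rho (- 2 * L%:C)) He).
  by apply: eq_poly_limit => [z|] /=; rewrite ?cexp0; ring.
have H2 (v : node) : poly_limit rho (fun z : C => cexp (z * (depth v)%:R))
    (depth v)%:R.
  have := poly_limit_cexp r0 (poly_limitM r0 (poly_limit_id rho)
    (poly_limit_cst rho (depth v)%:R)).
  by apply: eq_poly_limit => [z|] /=; rewrite ?mul0r ?cexp0//; ring.
have := poly_limitM r0 (poly_limit_cexp r0 H1)
  (poly_limit_sum (external_nodes t) H2).
apply: eq_poly_limit => [z|] //=.
have -> : cexp (- (2 * cexp 0 - 1) * L%:C) = (expR (- L))%:C :> C.
  by rewrite cexp0 -cexpC rmorphN; congr cexp; ring.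
have -> : \sum_(v <- external_nodes t) cexp (0 * (depth v)%:R) =
    (size (external_nodes t))%:R :> C.
  under eq_bigr do rewrite mul0r cexp0.
  by rewrite big_const_seq count_predT iter_addr_0.
rewrite /biggins_deriv /depths big_map -/t -/L rmorphM rmorphB rmorphM.
rewrite rmorph_sum !rmorphM !rmorph_nat.
under [in RHS]eq_bigr do rewrite rmorph_nat.
by ring.
Qed.

(** This is how the limit [W] enters: it identifies the limit of the centred
    mean depth, which is the explicit derivative of [W_n] up to a vanishing
    correction. *)
Lemma biggins_deriv_cvg {d : measure_display} {T : measurableType d}
    (pick : nat -> T -> node) (w : T) (D : set C^o) (W : T -> C^o -> C^o) :
  open D -> D 0 -> derivable (W w) 0 1 ->
  (forall A : set C^o, compact A -> A `<=` D ->
    {uniform A, (fun n => biggins pick n w) @ \oo --> W w}) ->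
  biggins_deriv n (bst_tree pick n w) @[n --> \oo] --> chi1 W w.
Proof.
move=> oD D0 dW unif; apply/cvgrPdist_le => e e0.
have [d1 d10 d1D] := nbhs0_nm (open_nbhs_nbhs (conj oD D0)).
have e4 : 0 < e / 4 by rewrite divr_gt0.
have [d2 d20 d2W] := derive1_nm dW e4.
pose rho := Num.min d1 d2 / 2.
have m0 : 0 < Num.min d1 d2 by rewrite lt_min d10 d20.
have r0 : 0 < rho by rewrite divr_gt0.
have rm : rho < Num.min d1 d2 by rewrite ltr_pdivrMr// ltr_pMr// ltr1n.
move: rm; rewrite lt_min => /andP[rd1 rd2].
have cD : (circ rho : R -> C^o) @` `[0, pi *+ 2] `<=` D.
  by move=> _ [t _ <-]; apply: d1D; rewrite nm_circ ?ltW.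
have := uniform_nm (unif _ (@circ_compact rho) cD) (mulr_gt0 e4 r0).
apply: filterS => n hn; set b := biggins_deriv _ _.
have h : nm (b%:C - derive1 (W w) 0) <= 4 * (e / 4).
  apply: (deriv_close r0 e4 (biggins_poly_limit pick n w (ltW r0))
    (F := W w)) => t t0.
    by rewrite -[X in _ <= _ * X](nm_circ t (ltW r0)); apply: d2W; rewrite nm_circ ?ltW.
  by apply: hn; exists t => //=; rewrite in_itv.
rewrite distrC; have -> : b - chi1 W w = complex.Re (b%:C - derive1 (W w) 0).
  by rewrite /chi1; case: (derive1 _ _).
apply: le_trans (Re_le_nm _) (le_trans h _).
by rewrite mulrC divfK.
Qed.

End BigginsDerivative.

(** * Almost sure bounds on the tree at an early time *)

Section EarlyTree.
Set Implicit Arguments. Unset Strict Implicit.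
Context {R : realType}.
Local Notation C := (R[i]).
Local Notation nm := (@Normc.normc R).
Local Open Scope complex_scope.
Implicit Types (xs : seq nat) (t : bst).

(** The function [2 * expR b * (1 - b)] increases up to [0] and decreases
    afterwards, so its two roots lie on either side of [0]. *)
Lemma roots_around0 (bm bp : R) : bm < bp ->
  2 * expR bm * (1 - bm) = 1 -> 2 * expR bp * (1 - bp) = 1 -> bm < 0 < bp.
Proof.
move=> b hm hp; pose t := bp - bm; have t0 : 0 < t by rewrite subr_gt0.
have em := expR_gt0 bm; have ep := expR_gt0 bp.
have E : expR t * (1 - bp) = 1 - bm.
  apply: (@mulfI _ (2 * expR bm)); first by rewrite mulf_neq0 ?gt_eqF.
  have bt : bm + t = bp by rewrite /t addrC subrK.
  by rewrite hm mulrA -(mulrA 2) -expRD bt.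
have sp : 0 < 1 - bp.
  rewrite -(@pmulr_rgt0 _ (2 * expR bp)) ?hp//; by rewrite mulr_gt0.
have e1 : 1 + t < expR t by apply: expR_gt1Dx; rewrite gt_eqF.
have e2 : 1 - t < expR (- t) by apply: expR_gt1Dx; rewrite oppr_eq0 gt_eqF.
have e3 : expR t * expR (- t) = 1 by exact: expRxMexpNx_1.
have et := expR_gt0 t.
apply/andP; split; rewrite ltNge; apply/negP => h.
  have : expR t * (1 - t) < 1 by rewrite -[ltRHS]e3 ltr_pM2l.
  have : (expR t - 1) * (1 - bp) <= (expR t - 1) * (1 - t).
    by rewrite ler_wpM2l//; rewrite /t in e1 *; lra.
  by rewrite mulrBl E mul1r /t; lra.
have : (1 + t) * (1 - bp) < expR t * (1 - bp) by rewrite ltr_pM2r.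
have : 0 <= t * (- bp) by rewrite mulr_ge0 ?(ltW t0)// oppr_ge0.
by rewrite E /t; lra.
Qed.

(** The exponential term is there only to absorb [x] larger than [c], through
    [expR u >= u ^+ 2 / 2] and [x ^+ 2 <= 2 * c ^+ 2 + 2 * (x - c) ^+ 2]. *)
Lemma sqr_le_expR (b c x : R) : 0 < b -> 0 <= c -> 0 <= x ->
  x ^+ 2 <= 2 * c ^+ 2 + 4 / b ^+ 2 * expR (b * (x - c)).
Proof.
move=> b0 c0 x0; have h0 : 0 <= 4 / b ^+ 2 * expR (b * (x - c)).
  by rewrite mulr_ge0 ?expR_ge0// divr_ge0// sqr_ge0.
have [xc|xc] := leP x c.
  have : x ^+ 2 <= c ^+ 2 by rewrite ler_sqr.
  by have := sqr_ge0 c; lra.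
have u0 : 0 <= b * (x - c) by rewrite mulr_ge0 ?(ltW b0)//; lra.
have := expR_ge1Dxn 1 u0; rewrite (_ : 2`! = 2)%N// => h.
have -> : x ^+ 2 = 2 * c ^+ 2 + 4 / b ^+ 2 * ((b * (x - c)) ^+ 2 / 2)
    - (2 * c - x) ^+ 2 by field; rewrite gt_eqF.
have : 4 / b ^+ 2 * ((b * (x - c)) ^+ 2 / 2) <= 4 / b ^+ 2 * expR (b * (x - c)).
  by rewrite ler_wpM2l ?divr_ge0 ?sqr_ge0//; lra.
by have := sqr_ge0 (2 * c - x); lra.
Qed.

Lemma sqr_mean_le xs : (0 < size xs)%N -> (mean xs : R) ^+ 2 <= mean_sqr xs.
Proof.
move=> xs0; have n0 : (size xs)%:R != 0 :> R by rewrite pnatr_eq0 -lt0n.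
have n1 : 0 < (size xs)%:R :> R by rewrite ltr0n.
have : 0 <= \sum_(x <- xs) (x%:R - mean xs) ^+ 2 :> R.
  by apply: sumr_ge0 => x _; exact: sqr_ge0.
have -> : \sum_(x <- xs) (x%:R - mean xs) ^+ 2 =
    (size xs)%:R * (mean_sqr xs - mean xs ^+ 2) :> R.
  under eq_bigr => x _.
    rewrite (_ : _ ^+ 2 = x%:R ^+ 2 + (- 2 * mean xs * x%:R + mean xs ^+ 2));
      last by ring.
    over.
  rewrite big_split big_split/= -mulr_sumr big_const_seq count_predT iter_addr_0.
  have -> : \sum_(x <- xs) x%:R = mean xs * (size xs)%:R :> R by rewrite mulfVK.
  have -> : \sum_(x <- xs) x%:R ^+ 2 = mean_sqr xs * (size xs)%:R :> R.
    by rewrite mulfVK.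
  by rewrite -[_ *+ _]mulr_natl; ring.
by rewrite pmulr_rge0// subr_ge0.
Qed.

(** The level [a * ln m.+1], with [b * a = 2 * expR b - 2], is the one at which
    [expR (b * x)] has the size of its average over the nodes, so the
    exponential moment controls the nodes below it. *)
Lemma mean_sqr_le t m (b B : R) : 0 < b -> size (external_nodes t) = m.+2 ->
  expR (- (2 * expR b - 1) * ln m.+1%:R) *
    \sum_(x <- depths t) expR (b * x%:R) <= B ->
  mean_sqr (depths t) <=
    2 * ((2 * expR b - 2) / b) ^+ 2 * ln m.+1%:R ^+ 2 + 4 / b ^+ 2 * B.
Proof.
move=> b0 tm; set L := ln _; set a := (2 * expR b - 2) / b; set S := \sum_(x <- _) _.
move=> SB; have L0 : 0 <= L by apply: ln_ge0; rewrite ler1n.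
have a0 : 0 <= a.
  by rewrite divr_ge0 ?(ltW b0)//; have := expR_ge1Dx b; lra.
have B0 : 0 <= B.
  apply: le_trans SB; rewrite mulr_ge0 ?expR_ge0//.
  by apply: sumr_ge0 => x _; exact: expR_ge0.
have b2 : 0 <= 4 / b ^+ 2 by rewrite divr_ge0// sqr_ge0.
rewrite /mean_sqr ler_pdivrMr size_depths tm ?ltr0n//.
apply: (@le_trans _ _ (\sum_(x <- depths t)
    (2 * (a * L) ^+ 2 + 4 / b ^+ 2 * expR (b * (x%:R - a * L))))).
  by apply: ler_sum => x _; apply: sqr_le_expR => //; rewrite mulr_ge0.
rewrite big_split/= big_const_seq count_predT iter_addr_0 size_depths tm.
rewrite -mulr_sumr -[X in X + _]mulr_natr.
have -> : (2 * a ^+ 2 * L ^+ 2 + 4 / b ^+ 2 * B) * m.+2%:R =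
  2 * (a * L) ^+ 2 * m.+2%:R + 4 / b ^+ 2 * (B * m.+2%:R) by ring.
rewrite lerD2l ler_wpM2l//.
have -> : \sum_(x <- depths t) expR (b * (x%:R - a * L)) =
    expR (- (2 * expR b - 1) * L) * S * expR L.
  rewrite [RHS]mulrAC -expRD mulr_sumr; apply: eq_bigr => x _; rewrite -expRD.
  by congr expR; rewrite /a; field; rewrite gt_eqF.
rewrite /L lnK ?posrE ?ltr0n// ler_pM//.
- rewrite mulr_ge0 ?expR_ge0//; apply: sumr_ge0 => x _; exact: expR_ge0.
- by rewrite ler_nat.
Qed.

Lemma biggins_real_bounded {d : measure_display} {T : measurableType d}
    (pick : nat -> T -> node) (w : T) (D : set C^o) (W : T -> C^o -> C^o) (b : R) :
  D b%:C ->
  (forall A : set C^o, compact A -> A `<=` D ->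
    {uniform A, (fun n => biggins pick n w) @ \oo --> W w}) ->
  exists B : R, \forall n \near \oo,
    expR (- (2 * expR b - 1) * ln n%:R) *
      \sum_(x <- depths (bst_tree pick n w)) expR (b * x%:R) <= B.
Proof.
move=> Db unif; exists (nm (W w b%:C) + 1).
have sD : [set b%:C : C^o] `<=` D by move=> _ ->.
have := uniform_nm (unif _ (@compact_set1 _ _) sD) ltr01.
apply: filterS => n /(_ b%:C erefl).
have -> : biggins pick n w b%:C = (expR (- (2 * expR b - 1) * ln n%:R) *
      \sum_(x <- depths (bst_tree pick n w)) expR (b * x%:R))%:C.
  rewrite /biggins /depths big_map rmorphM rmorph_sum; congr (_ * _).
    apply: etrans (cexpC _); congr cexp; rewrite cexpC.
    by rewrite rmorphM rmorphN rmorphB rmorphM rmorph_nat.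
  apply: eq_bigr => v _; apply: etrans (cexpC _); congr cexp.
  by rewrite rmorphM rmorph_nat.
set x := expR _ * _ => h.
have h1 := le_normcD (x%:C - W w b%:C) (W w b%:C); rewrite subrK in h1.
have h2 : x <= nm x%:C by rewrite nmC ler_norm.
rewrite (le_trans h2)// (le_trans h1)// addrC lerD2l.
exact: h.
Qed.

End EarlyTree.

(** * The mode along the whole sequence of trees *)

Section Scales.
Set Implicit Arguments. Unset Strict Implicit.
Context {R : realType}.

(** For [n] between [2 ^ i] and [2 ^ i.+1], the tree at time [early i] plays the
    role of the past, and deviations are controlled at the times [grid i r],
    [r < i ^ 2]. The exponents balance: the deviation allowed, [i ^- 2], must be
    below the size [i ^ (-3/2)] of the differences of the profile, the mesh may
    not exceed the deviation, and the probabilities, [i ^ 2] times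
    [i ^ 4 / early i], must be summable. *)
Definition early i : nat := (i ^ 8)%N.
Definition mesh i : nat := (2 ^ i %/ i ^ 2).+1.
Definition grid i r : nat := (2 ^ i + mesh i * r)%N.

Lemma smear_lipschitz xs (f g : nat -> R) B k : (0 < size xs)%N ->
  (forall j, `|f j - g j| <= B) -> `|smear xs f k - smear xs g k| <= B.
Proof.
move=> xs0 fg; have B0 : 0 <= B := le_trans (normr_ge0 _) (fg 0%N).
have n0 : 0 < (size xs)%:R :> R by rewrite ltr0n.
rewrite /smear -mulrBl -sumrB normrM normfV normr_nat ler_pdivrMr//.
apply: le_trans (ler_norm_sum _ _ _) _.
rewrite mulr_natr -iter_addr_0 -count_predT -big_const_seq ler_sum// => x _.
by rewrite !iter_delayE; case: ifP => // _; rewrite subrr normr0.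
Qed.

Lemma ln2_bounds : 1 / 2 <= ln (2 : R) <= 1.
Proof.
apply/andP; split; last first.
  by have := @le_ln1Dx R 1; rewrite (_ : 1 + 1 = 2)//; apply; lra.
have h := expR_ge1Dx (- (1 / 2) : R).
have e1 : expR (1 / 2) * expR (- (1 / 2)) = 1 :> R by exact: expRxMexpNx_1.
have e0 := expR_gt0 (1 / 2 : R).
have e2 : expR (1 / 2) <= 2 :> R.
  have : expR (1 / 2) * (1 / 2) <= 1 :> R by rewrite -[leRHS]e1 ler_wpM2l//; lra.
  lra.
by rewrite -(expRK (1 / 2)) ler_ln ?posrE.
Qed.

Lemma ln_ratio_close (x y : R) : 0 < x -> x <= y -> ln y - ln x <= (y - x) / x.
Proof.
move=> x0 xy; have y0 : 0 < y := lt_le_trans x0 xy.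
rewrite -ln_div ?posrE//.
have -> : y / x = 1 + (y - x) / x by field; rewrite gt_eqF.
by apply: le_ln1Dx; rewrite (@lt_le_trans _ _ 0)// divr_ge0 ?subr_ge0// ltW.
Qed.

(* All orders of magnitude are expressed in the eighth root [q] of [i], with
   respect to which [ln i] is at most linear. *)
Variables (i r n : nat) (q : R).
Hypothesis q_large : 2 ^+ 17 <= q.
Hypothesis qi : q ^+ 8 = i%:R.
Hypothesis n_grid : (grid i r <= n)%N.
Hypothesis n_mesh : (n < grid i r + mesh i)%N.
Hypothesis n_top : (n < 2 ^ i.+1)%N.

Lemma q_facts : [/\ 1 <= q, 2 ^+ 17 * q ^+ 7 <= i%:R & 2 ^+ 17 * q <= i%:R].
Proof.
have ql := q_large; have q1 : 1 <= q by apply: le_trans ql; rewrite exprn_ege1// ler1n.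
have h1 : 2 ^+ 17 * q ^+ 7 <= i%:R.
  by rewrite -qi exprS ler_wpM2r// exprn_ge0//; lra.
split=> //; apply: le_trans h1; rewrite ler_wpM2l// -[leLHS]expr1.
by rewrite ler_weXn2l.
Qed.

Lemma ln_i_le : ln i%:R <= 8 * q.
Proof.
have [q1 _ _] := q_facts; have q0 : 0 < q by lra.
rewrite -qi lnXn// mulr_natl lerMn2r/=.
exact: ltW (ln_sublinear q0).
Qed.

Lemma q16 : q ^+ 16 = i%:R ^+ 2.
Proof. by rewrite -qi -exprM. Qed.

Lemma i_gt0 : (0 < i)%N.
Proof. by have [q1 _ h] := q_facts; rewrite -(ltr_nat R); lra. Qed.

Lemma early_le : (early i <= 2 ^ i)%N.
Proof.
have [q1 _ h] := q_facts; have i0 := i_gt0.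
rewrite -(ler_nat R) -ler_ln ?posrE ?ltr0n ?expn_gt0 ?i0//.
rewrite /early !natrX !lnXn ?ltr0n// -[leLHS]mulr_natl -[leRHS]mulr_natl.
have := ln_i_le; have /andP[l1 l2] := ln2_bounds => l3.
have : i%:R * (1 / 2) <= i%:R * ln 2 :> R by rewrite ler_wpM2l.
lra.
Qed.

Let m := early i.
Let n' := grid i r.
Let s : R := hop_sum m (n' - m).

Lemma early_grid : (m + (n' - m))%N = n'.
Proof. by rewrite subnKC// /n' /grid (leq_trans early_le)// leq_addr. Qed.

Lemma mean_bounds :
  `|s - 2 * (ln n'.+1%:R - ln m.+1%:R)| <= 2 / m.+1%:R /\
  q ^+ 8 / 4 <= s <= 4 * q ^+ 8.
Proof.
have [q1 h7 h] := q_facts; have i0 := i_gt0; have /andP[l1 l2] := ln2_bounds.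
have := @hop_sum_ln R m (n' - m); rewrite early_grid => H; split => //.
have m1 : 2 / m.+1%:R <= 2 :> R.
  by rewrite ler_pdivrMr ?ltr0n// ler_peMr// ler1n.
have n1 : ln n'.+1%:R <= i.+1%:R * ln 2 :> R.
  rewrite mulr_natl -lnXn// -natrX ler_ln ?posrE ?ltr0n ?expn_gt0// ler_nat.
  exact: leq_ltn_trans n_grid n_top.
have n2 : i%:R * ln 2 <= ln n'.+1%:R :> R.
  rewrite mulr_natl -lnXn// -natrX ler_ln ?posrE ?ltr0n ?expn_gt0// ler_nat.
  by rewrite leqW// leq_addr.
have n3 : i%:R * (1 / 2) <= i%:R * ln 2 :> R by rewrite ler_wpM2l.
have n4 : i.+1%:R * ln 2 <= i.+1%:R * 1 :> R by rewrite ler_wpM2l.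
have m2 : 0 <= ln m.+1%:R :> R by rewrite ln_ge0// ler1n.
have m3 : ln m.+1%:R <= 64 * q + 1.
  have m0 : (0 < m)%N by rewrite expn_gt0 i0.
  have := @ln_ratio_close m%:R m.+1%:R; rewrite ltr0n m0 ler_nat leqnSn.
  move=> /(_ isT isT); rewrite -natrB// subSnn => h1.
  have h2 : 1%:R / m%:R <= 1 :> R by rewrite ler_pdivrMr ?ltr0n// mul1r ler1n.
  have h3 : ln m%:R <= 8 * (8 * q) :> R.
    by rewrite /m /early natrX lnXn ?ltr0n// -[leLHS]mulr_natl ler_wpM2l// ln_i_le.
  lra.
rewrite -[i.+1%:R]natr1 in n1 n4; rewrite qi.
move: H; rewrite -/s ler_norml => /andP[].
move: (ln n'.+1%:R) (ln m.+1%:R) s (2 / m.+1%:R) n1 n2 m2 m3 m1 => a b u v.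
by move=> ? ? ? ? ? ? ?; apply/andP; split; lra.
Qed.

Lemma mesh_error : (n - n')%:R / n'.+1%:R <= 1 / q ^+ 16.
Proof.
have i0 := i_gt0; rewrite q16 ler_pdivrMr ?ltr0n//.
rewrite mul1r mulrC ler_pdivlMr ?exprn_gt0 ?ltr0n// -natrX -natrM ler_nat.
have h : (n - n' <= 2 ^ i %/ i ^ 2)%N by rewrite leq_subLR -ltnS -addnS.
apply: leq_trans (leq_mul h (leqnn _)) (leq_trans (leq_trunc_div _ _) _).
by rewrite leqW// leq_addr.
Qed.

Lemma early_error : 1 / m.+1%:R <= 1 / q ^+ 16 :> R.
Proof.
have [q1 _ _] := q_facts; have i0 := i_gt0.
rewrite !mul1r lef_pV2 ?posrE ?ltr0n ?exprn_gt0//; last by lra.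
rewrite q16 -natrX ler_nat leqW// /m /early.
by rewrite leq_pexp2l.
Qed.

Lemma ln_grid_close : `|ln n%:R - ln n'.+1%:R| <= 1 / q ^+ 16.
Proof.
have [q1 _ h] := q_facts; have i0 := i_gt0.
have n0 : (0 < n')%N by rewrite /n' /grid addn_gt0 expn_gt0.
have i2 : 1 / n'%:R <= 1 / q ^+ 16 :> R.
  rewrite !mul1r lef_pV2 ?posrE ?ltr0n ?exprn_gt0//; last by lra.
  rewrite q16 -natrX ler_nat.
  apply: (@leq_trans (early i)); first by rewrite leq_pexp2l.
  by rewrite (leq_trans early_le)// leq_addr.
have [nn|nn] := leqP n'.+1 n.
  have nr : n'.+1%:R <= n%:R :> R by rewrite ler_nat.
  have := ln_ratio_close (ltr0Sn R n') nr.
  rewrite ger0_norm ?subr_ge0 ?ler_ln ?posrE ?ltr0n ?(leq_trans _ nn)//.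
  move=> /le_trans; apply; apply: le_trans mesh_error.
  by rewrite ler_wpM2r ?invr_ge0// -natrB// ler_nat leq_sub2l.
have -> : n = n' by apply/eqP; rewrite eqn_leq -ltnS nn.
rewrite distrC; have := @ln_ratio_close n'%:R n'.+1%:R.
rewrite ltr0n n0 ler_nat leqnSn -natrB// subSnn => /(_ isT isT) h1.
rewrite ger0_norm ?subr_ge0 ?ler_ln ?posrE ?ltr0n ?ler_nat//; lra.
Qed.

End Scales.

Section ModeAt.
Set Implicit Arguments. Unset Strict Implicit.
Context {R : realType} {d : measure_display} {T : measurableType d}.
Context {P : probability T R} {pick : nat -> T -> node}.
Hypothesis Hpick : bst_process P pick.
Local Notation tree := (bst_tree pick).

Lemma prof_lipschitz n n' k w : (n' <= n)%N ->
  `|(prof (tree n w) k)%:R - (prof (tree n' w) k)%:R| <= 2 * (n - n')%:R :> R.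
Proof.
move=> /subnKC <-; rewrite addKn; elim: (n - n')%N => [|j IH].
  by rewrite addn0 subrr normr0 mulr0.
have [h1 h2] := @grow_prof (tree (n' + j) w) (pick (n' + j)%N w) k
  (pick_external Hpick _ _).
rewrite addnS -[tree (n' + j).+1 w]/(grow (tree (n' + j) w) (pick (n' + j)%N w)).
set a := prof (grow _ _) k in h1 h2 *.
have -> : a%:R - (prof (tree n' w) k)%:R =
  (a%:R - (prof (tree (n' + j) w) k)%:R)
  + ((prof (tree (n' + j) w) k)%:R - (prof (tree n' w) k)%:R) :> R by ring.
rewrite (le_trans (ler_normD _ _))// -[j.+1%:R]natr1 mulrDr mulr1 addrC lerD//.
rewrite ler_norml; move: h1 h2; rewrite -!(ler_nat R) !natrD; lra.
Qed.

(** The error in [mode_close] has three sources, each at most of order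
    [i ^- 2 = q ^- 16]: the steps since the last grid time, the fluctuation at
    that time, and the Poisson approximation of the kernel. The fourth power of
    [q] is the order of the standard deviation [y]. *)
Lemma mode_at (i r n : nat) (q chi A B : R) w k :
  2 ^+ 17 <= q -> q ^+ 8 = i%:R ->
  (grid i r <= n)%N -> (n < grid i r + mesh i)%N -> (n < 2 ^ i.+1)%N ->
  0 <= A -> 0 <= B -> 2 ^+ 61 * (2 ^+ 12 * A + B) <= q ->
  mean_sqr (depths (tree (early i) w)) <= A * ln (early i)%:R ^+ 2 + B ->
  `|mean (depths (tree (early i) w)) - 2 * ln (early i)%:R - chi| <= 1 / 32 ->
  ~ deviates (pick := pick) (early i) (grid i r - early i) ((i%:R : R) ^+ 2)^-1 w ->
  modes pick n w k ->
  2 * ln n%:R + chi - 2^-1 - 1 < k%:R < 2 * ln n%:R + chi - 2^-1 + 1.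
Proof.
move=> ql qi ng nm nt A0 B0 qAB m2 mchi ndev km.
have [q1 h7 h1] := q_facts ql qi.
set m := early i in m2 mchi ndev *; set n' := grid i r in ng nm ndev *.
have eg : (m + (n' - m))%N = n' := early_grid r ql qi.
have [sln /andP[s1 s2]] := mean_bounds ql qi ng nt.
have me := mesh_error ql qi nm; have ee := early_error ql qi.
have lg := ln_grid_close ql qi ng nm; rewrite -/n' -/m in sln s1 s2 me ee lg.
have iq := q16 qi.
set s := hop_sum m (n' - m) in sln s1 s2.
pose y := Num.sqrt s; pose xs := depths (tree m w).
have q0 : 0 < q by lra.
have s0 : 0 < s by apply: lt_le_trans s1; rewrite divr_gt0 ?exprn_gt0.
have ys : y ^+ 2 = s by rewrite sqr_sqrtr// ltW.
have y0 : 0 <= y by exact: sqrtr_ge0.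
have q4 : 0 <= q ^+ 4 by rewrite exprn_ge0// ltW.
have y1 : q ^+ 4 / 2 <= y.
  rewrite -ler_sqr ?nnegrE ?divr_ge0// ys; apply: le_trans s1.
  by rewrite expr_div_n -exprM -natrX.
have y2 : y <= 2 * q ^+ 4.
  suff : y ^+ 2 <= (2 * q ^+ 4) ^+ 2 by rewrite ler_sqr ?nnegrE// mulr_ge0.
  by rewrite ys exprMn -exprM -natrX.
have q43 : 2 ^+ 51 * q <= q ^+ 4.
  have -> : 2 ^+ 51 * q = (2 ^+ 17) ^+ 3 * q by rewrite -exprM.
  by rewrite [leRHS]exprSr ler_pM2r// lerXn2r ?nnegrE ?(ltW q0)// exprn_ge0.
have lm : ln m%:R <= 64 * q :> R.
  rewrite /m /early natrX lnXn ?ltr0n ?(i_gt0 ql qi)// -[leLHS]mulr_natl.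
  by have := ln_i_le ql qi; lra.
have m1 : (0 < m)%N by rewrite expn_gt0 (i_gt0 ql qi).
have lm0 : 0 <= ln m%:R :> R by rewrite ln_ge0// ler1n.
have m2y : mean_sqr xs <= y / 2 ^+ 60.
  apply: le_trans m2 _.
  have e1 : ln m%:R ^+ 2 <= (64 * q) ^+ 2 :> R by rewrite lerXn2r ?nnegrE ?mulr_ge0// ltW.
  have e2 : 1 <= q ^+ 2 by rewrite exprn_ege1.
  have e3 : A * ln m%:R ^+ 2 <= A * (64 * q) ^+ 2 by rewrite ler_wpM2l.
  have e4 : B * 1 <= B * q ^+ 2 by rewrite ler_wpM2l.
  have e5 : 2 ^+ 61 * (2 ^+ 12 * A + B) * q ^+ 2 <= q * q ^+ 2 by rewrite ler_wpM2r// sqr_ge0.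
  have e6 : q ^+ 3 * 1 <= q ^+ 3 * q by rewrite ler_wpM2l// exprn_ge0// ltW.
  lra.
have size_xs : (0 < size xs)%N by rewrite size_depths external_nodes_gt0.
pose l j : R := (prof (tree n w) j)%:R / n'.+1%:R.
have n'0 : 0 < n'.+1%:R :> R by rewrite ltr0n.
apply: (mode_close (s := s) (y := y) (xs := xs) (l := l) (eps := 15 / q ^+ 16)) => //.
- by apply: le_trans y1; lra.
- exact: le_trans (sqr_mean_le size_xs) m2y.
- have y3 : y ^+ 3 <= (2 * q ^+ 4) ^+ 3 by rewrite lerXn2r ?nnegrE// mulr_ge0.
  have y0' : 0 < y by apply: lt_le_trans y1; rewrite divr_gt0 ?exprn_gt0.
  rewrite ler_pdivrMr ?exprn_gt0// mulrC ler_pdivlMr ?mulr_gt0 ?exprn_gt0//.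
  apply: (@le_trans _ _ (15 * (2 ^+ 60 * (2 * q ^+ 4) ^+ 3))).
    by rewrite !ler_wpM2l.
  have -> : 15 * (2 ^+ 60 * (2 * q ^+ 4) ^+ 3) = 15 * 2 ^+ 63 * q ^+ 12 by ring.
  have -> : q ^+ 16 = q ^+ 4 * q ^+ 12 by rewrite -exprD.
  by rewrite ler_wpM2r ?exprn_ge0 ?(ltW q0)//; lra.
- move=> j.
  have dev : `|(prof (tree n' w) j)%:R - n'.+1%:R * smear xs (kernel m (n' - m)) j|
      <= 1 / q ^+ 16 * n'.+1%:R.
    rewrite leNgt; apply/negP => h; apply: ndev; exists j.
    by rewrite eg; move: h; rewrite iq mul1r.
  have kp : `|smear xs (kernel m (n' - m)) j - smear xs (poi s) j| <= 12 * (1 / q ^+ 16).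
    apply: smear_lipschitz => // h; apply: le_trans (kernel_poi _ _ _) _.
    by rewrite ler_wpM2l// -[leLHS]mul1r.
  have lp : `|(prof (tree n w) j)%:R - (prof (tree n' w) j)%:R|
      <= 2 * (1 / q ^+ 16) * n'.+1%:R :> R.
    apply: le_trans (prof_lipschitz _ _ ng) _.
    by rewrite -mulrA ler_wpM2l// -ler_pdivrMr.
  have -> : l j - smear xs (poi s) j =
     ((prof (tree n w) j)%:R - (prof (tree n' w) j)%:R) / n'.+1%:R
     + ((prof (tree n' w) j)%:R - n'.+1%:R * smear xs (kernel m (n' - m)) j) / n'.+1%:R
     + (smear xs (kernel m (n' - m)) j - smear xs (poi s) j).
    by rewrite /l; field; rewrite addrC natr1 pnatr_eq0.
  apply: le_trans (ler_normD _ _) _.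
  apply: le_trans (lerD (ler_normD _ _) kp) _.
  rewrite !normrM normfV (gtr0_norm n'0).
  have lp' := lp; have dev' := dev.
  rewrite -ler_pdivrMr// in lp'; rewrite -ler_pdivrMr// in dev'.
  have -> : 15 / q ^+ 16 = 2 * (1 / q ^+ 16) + 1 / q ^+ 16 + 12 * (1 / q ^+ 16) by ring.
  by rewrite !lerD.
- have q16s : 1 / q ^+ 16 <= 1 / 2 ^+ 10.
    have q16l : 2 ^+ 10 <= q ^+ 16.
      apply: (@le_trans _ _ (q ^+ 1)); last by rewrite ler_weXn2l.
      by rewrite expr1; lra.
    by rewrite !mul1r lef_pV2 ?posrE ?exprn_gt0.
  have mm : ln m.+1%:R - ln m%:R <= 2 * (1 / m.+1%:R) :> R.
    have := @ln_ratio_close R m%:R m.+1%:R; rewrite ltr0n m1 ler_nat leqnSn.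
    move=> /(_ isT isT); rewrite -natrB// subSnn => /le_trans; apply.
    rewrite [leRHS]mulrA mulr1 ler_pdivrMr ?ltr0n// mulrAC ler_pdivlMr ?ltr0n//.
    rewrite mul1r.
    by rewrite -natrM ler_nat mul2n -addnn -addn1 leq_add2l.
  have mm0 : 0 <= ln m.+1%:R - ln m%:R :> R.
    by rewrite subr_ge0 ler_ln ?posrE ?ltr0n// ler_nat.
  have sln' : `|s - 2 * (ln n'.+1%:R - ln m.+1%:R)| <= 2 * (1 / m.+1%:R).
    by rewrite mul1r.
  move: sln' mm mm0 mchi lg; rewrite -/xs.
  move: (ln m%:R) (ln m.+1%:R) (ln n'.+1%:R) (ln n%:R) (mean xs) ee q16s.
  move: (1 / m.+1%:R) (1 / q ^+ 16) => u v a b c e f.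
  by rewrite !ler_norml => ? ? /andP[? ?] ? ? /andP[? ?] /andP[? ?]; apply/andP; split; lra.
- by move=> j; rewrite /l ler_wpM2r ?invr_ge0 ?(ltW n'0)// ler_nat; exact: km.
Qed.

End ModeAt.

Section Eventually.
Set Implicit Arguments. Unset Strict Implicit.
Context {R : realType} {d : measure_display} {T : measurableType d}.
Context {P : probability T R} {pick : nat -> T -> node}.
Hypothesis Hpick : bst_process P pick.
Local Notation tree := (bst_tree pick).

Definition eighth_root (i : nat) : R := Num.sqrt (Num.sqrt (Num.sqrt i%:R)).

Lemma eighth_rootX i : eighth_root i ^+ 8 = i%:R.
Proof.
rewrite (exprM _ 2 4) sqr_sqrtr ?sqrtr_ge0// (exprM _ 2 2) sqr_sqrtr ?sqrtr_ge0//.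
by rewrite sqr_sqrtr.
Qed.

Lemma eighth_root_large (Q : R) : 0 <= Q ->
  exists I : nat, forall i, (I <= i)%N -> Q <= eighth_root i.
Proof.
move=> Q0; exists (Num.truncn (Q ^+ 8)).+1 => i Ii.
have h : Q ^+ 8 <= i%:R.
  by rewrite (le_trans (ltW (truncnS_gt _)))// ler_nat.
suff : Q ^+ 8 <= eighth_root i ^+ 8 by rewrite ler_pXn2r ?nnegrE ?sqrtr_ge0.
by rewrite eighth_rootX.
Qed.

(** There are [m.+1] external nodes while [W_m] is normalised by [m], whence the
    small discrepancy between the centred mean and [W_m'(0)]. *)
Lemma mean_of_deriv m (chi : R) w : (0 < m)%N -> 64 * (`|chi| + 1) <= m%:R ->
  `|chi - biggins_deriv m (tree m w)| <= 1 / 64 ->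
  `|mean (depths (tree m w)) - 2 * ln m%:R - chi| <= 1 / 32.
Proof.
move=> m0 mchi; set b := biggins_deriv _ _ => h.
have mp : 0 < m%:R :> R by rewrite ltr0n.
have m1 : m.+1%:R = m%:R + 1 :> R by rewrite natr1.
have E : mean (depths (tree m w)) - 2 * ln m%:R = b - b / m.+1%:R.
  rewrite /b /biggins_deriv /mean size_depths (size_tree Hpick) expRN lnK ?posrE//.
  rewrite m1; field; rewrite ?(gt_eqF mp)//=.
  by rewrite gt_eqF// addr_gt0.
have b1 : `|b| <= `|chi| + 1.
  rewrite -(subrK chi b) (le_trans (ler_normD _ _))// addrC lerD2l distrC; lra.
have b2 : `|b / m.+1%:R| <= 1 / 64.
  rewrite normrM normfV normr_nat ler_pdivrMr ?ltr0n// m1; lra.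
rewrite E (_ : _ - chi = - (chi - b) - b / m.+1%:R); last by ring.
by rewrite (le_trans (ler_normB _ _))// normrN; lra.
Qed.

Definition bad i : set T :=
  \bigcup_(r in `I_(i ^ 2)%N)
    deviates (pick := pick) (early i) (grid i r - early i) ((i%:R : R) ^+ 2)^-1.

Lemma bad_measurable i : measurable (bad i).
Proof.
apply: fin_bigcup_measurable => // r _.
exact: (deviates_measurable Hpick).
Qed.

Lemma bad_prob i : (1 < i)%N -> (P (bad i) <= (10 / i%:R ^+ 2 : R)%:E)%E.
Proof.
move=> i1; have i0' : (0 < i)%N := ltnW i1; have i0 : 0 < i%:R :> R by rewrite ltr0n.
pose c : R := (i%:R ^+ 2)^-1.
have c0 : 0 < c by rewrite invr_gt0 exprn_gt0.
rewrite /bad bigcup_mkord.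
apply: (@le_trans _ _ (\sum_(r < (i ^ 2)%N) P
  (deviates (pick := pick) (early i) (grid i r - early i) c))%E).
  apply: (@content_subadditive _ _ _ P _ (fun r =>
      deviates (pick := pick) (early i) (grid i r - early i) c)) => //.
    by move=> r _; exact: (deviates_measurable Hpick).
  by apply: bigsetU_measurable => r _; exact: (deviates_measurable Hpick).
apply: (@le_trans _ _ (\sum_(r < (i ^ 2)%N) (10 / i%:R ^+ 4 : R)%:E)%E).
  apply: lee_sum => r _; apply: le_trans (deviation_prob Hpick _ _ c0) _.
  have c2 : c ^+ 2 = (i%:R ^+ 4)^-1 by rewrite /c exprVn -exprM.
  have i4 : 0 < i%:R ^+ 4 :> R by rewrite exprn_gt0.
  rewrite lee_fin ler_wpM2l// lef_pV2 ?posrE ?mulr_gt0 ?exprn_gt0 ?ltr0n//.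
  by rewrite c2 ler_pdivlMr// -exprD -natrX ler_nat /early leqW.
rewrite sumEFin lee_fin -sum_ord_const natrX le_eqVlt; apply/orP; left; apply/eqP.
by field; rewrite gt_eqF.
Qed.

Lemma bad_io_null : P (lim_sup_set (fun j => bad j.+2)) = 0%E.
Proof.
apply: lim_sup_set_cvg0 => [j|]; first exact: bad_measurable.
apply: (@le_lt_trans _ _ (10 : R)%:E); last exact: ltry.
apply: lime_le; first by apply: is_cvg_nneseries => j _ _; exact: measure_ge0.
apply: nearW => N.
apply: (@le_trans _ _ (\sum_(0 <= j < N) (10 / j.+2%:R ^+ 2 : R)%:E)%E).
  by apply: lee_sum => j _; exact: bad_prob.
rewrite sumEFin lee_fin big_mkord.
under eq_bigr do rewrite -exprVn -[X in _ * X.+2%:R^-1 ^+ 2]add0n.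
rewrite -mulr_sumr ger_pMr//; apply: le_trans (inv_sqr_sum _ _) _.
by rewrite invr1 gerBl invr_ge0.
Qed.

Lemma modes_eventually (chi A B : R) w : 0 <= A -> 0 <= B ->
  (\forall m \near \oo,
     mean_sqr (depths (tree m w)) <= A * ln m%:R ^+ 2 + B) ->
  biggins_deriv m (tree m w) @[m --> \oo] --> chi ->
  ~ lim_sup_set (fun j => bad j.+2) w ->
  exists K : nat, forall n k, (K <= n)%N -> modes pick n w k ->
    2 * ln n%:R + chi - 2^-1 - 1 < k%:R < 2 * ln n%:R + chi - 2^-1 + 1.
Proof.
move=> A0 B0 [N1 _ HN1] cchi nbad.
have [N2 _ HN2] : \forall m \near \oo,
    `|chi - biggins_deriv m (tree m w)| <= 1 / 64.
  by move/cvgrPdist_le : cchi; apply; lra.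
have [J HJ] : exists J, forall i, (J <= i)%N -> ~ bad i.+2 w.
  apply: contrapT => h; apply: nbad => j _.
  apply: contrapT => hj; apply: h; exists j => i ji bi; apply: hj.
  by exists i.
pose Q : R := 2 ^+ 17 + 2 ^+ 61 * (2 ^+ 12 * A + B).
have AB0 : 0 <= 2 ^+ 61 * (2 ^+ 12 * A + B).
  by rewrite mulr_ge0 ?exprn_ge0 ?addr_ge0 ?mulr_ge0 ?exprn_ge0.
have Q0 : 0 <= Q by rewrite addr_ge0 ?exprn_ge0.
have [I0 HI0] := eighth_root_large Q0.
pose t := Num.truncn (64 * (`|chi| + 1)).
pose I := (maxn I0 (J + N1 + N2 + t + 2)).+1.
exists (2 ^ I)%N => n k In.
have n0 : (0 < n)%N by rewrite (leq_trans _ In)// expn_gt0.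
pose i := trunc_log 2 n.
have /andP[i1 i2] : (2 ^ i <= n < 2 ^ i.+1)%N := trunc_log_bounds (isT : (1 < 2)%N) n0.
have Ii : (I <= i)%N by rewrite -ltnS -(ltn_exp2l _ _ (isT : 1 < 2)%N) (leq_ltn_trans In).
pose r := ((n - 2 ^ i) %/ mesh i)%N.
have ge : n = (grid i r + (n - 2 ^ i) %% mesh i)%N.
  by rewrite /grid /r mulnC -addnA -divn_eq subnKC.
have i0 : (0 < i)%N by exact: leq_trans Ii.
have ri : (r < i ^ 2)%N.
  rewrite ltn_divLR// mulnC; apply: leq_trans (_ : 2 ^ i <= _)%N.
    by rewrite ltn_subLR// addnn -mul2n -expnS.
  by rewrite ltnW// ltn_ceil// expn_gt0 i0.
have Ia : (I0 <= i)%N.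
  by apply: leq_trans (leq_trans (leqnSn _) Ii); exact: leq_maxl.
have Ib : (J + N1 + N2 + t + 2 < i)%N.
  by apply: leq_trans Ii; rewrite ltnS leq_maxr.
have [Ij I1 I2 It] : [/\ (J + 2 <= i)%N, (N1 <= i)%N, (N2 <= i)%N & (t < i)%N].
  by clear -Ib; clearbody t; split; lia.
have ie : (i <= early i)%N by rewrite /early -[X in (X <= _)%N]expn1 leq_pexp2l.
have qQ := HI0 _ Ia.
apply: (mode_at Hpick (q := eighth_root i) (r := r) _ (eighth_rootX i) _ _ i2 A0 B0).
- by apply: le_trans qQ; rewrite /Q lerDl.
- by rewrite [X in (_ <= X)%N]ge leq_addr.
- by rewrite [X in (X < _)%N]ge ltn_add2l ltn_pmod.
- by apply: le_trans qQ; rewrite /Q lerDr.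
- by apply: HN1 => /=; exact: leq_trans ie.
- apply: mean_of_deriv.
  + exact: leq_trans ie.
  + rewrite (le_trans (ltW (truncnS_gt _)))// ler_nat; exact: leq_trans ie.
  + by apply: HN2 => /=; exact: leq_trans ie.
- have e : i = (i - 2).+2 by clear -Ij; lia.
  move=> dv; apply: (HJ (i - 2)%N); first by clear -Ij; lia.
  by rewrite -e; exists r.
Qed.

End Eventually.

(** * A measurable bound on the last exceptional time *)

Section LastTime.
Set Implicit Arguments. Unset Strict Implicit.
Context {R : realType} {d : measure_display} {T : measurableType d}.

Lemma ae_null_superset (P : probability T R) (Q : T -> Prop) :
  {ae P, forall w, Q w} ->
  exists N : set T, [/\ measurable N, P N = 0%E & forall w, ~ N w -> Q w].
Proof.
move=> [N [mN PN sub]]; exists N; split => // w Nw.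
by apply: contrapT => nQ; apply: Nw; exact: sub.
Qed.

(** [K] is the supremum of the indices [n] with [B n w], made infinite on the
    null set [N], where that supremum is not under control. *)
Lemma last_time_exists (P : probability T R) (N : set T) (B : nat -> set T) :
  measurable N -> P N = 0%E -> (forall n, measurable (B n)) ->
  (forall w, ~ N w -> exists K, forall n, (K <= n)%N -> ~ B n w) ->
  exists K : T -> \bar R,
    [/\ measurable_fun [set: T] K, {ae P, forall w, K w \is a fin_num} &
        forall w n, (K w < n%:R%:E)%E -> ~ N w /\ ~ B n w].
Proof.
move=> mN PN mB HB.
have mfb (A : set T) : measurable A -> measurable_fun [set: T] (fun w => w \in A).
  move=> mA; apply: (measurable_fun_bool true); rewrite setTI.
  have -> : (fun w => w \in A) @^-1` [set true] = A; last exact: mA.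
  by apply/seteqP; split => w /=; [move/set_mem|move/mem_set].
pose f n w : \bar R := if w \in N then +oo%E else
  if w \in B n then n%:R%:E else 0%E.
have mf n : measurable_fun [set: T] (f n).
  apply: measurable_fun_ifT; [exact: mfb|exact: measurable_cst|].
  by apply: measurable_fun_ifT; [exact: mfb| |]; exact: measurable_cst.
have fK n w : (f n w <= esups (f ^~ w) 0%N)%E.
  by apply: ereal_sup_ubound; exists n.
exists (fun w => esups (f ^~ w) 0%N); split.
- exact: measurable_fun_esups.
- exists N; split => // w /= nfin; apply: contrapT => Nw; apply: nfin.
  have [K HK] := HB w Nw.
  rewrite fin_numElt; apply/andP; split.
    apply: lt_le_trans (fK 0%N w); rewrite /f memNset//.
    by case: ifP => _; exact: ltNyr.
  apply: (@le_lt_trans _ _ (K%:R%:E)); last exact: ltry.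
  apply: ge_ereal_sup => _ [n _ <-]; rewrite /f memNset//.
  case: ifPn => [/set_mem Bn|_]; rewrite lee_fin// ler_nat.
  by rewrite leqNgt; apply/negP => /ltnW /HK.
- move=> w n Kn; have := le_lt_trans (fK n w) Kn; rewrite /f.
  case: ifPn => [|/negP nN]; first by rewrite ltNge leey.
  case: ifPn => [|/negP nB _]; first by rewrite ltxx.
  by split => h; [apply: nN|apply: nB]; exact: mem_set.
Qed.

Lemma floor_or_ceil (a : R) (k : nat) : a - 1 < k%:R < a + 1 ->
  k%:Z = Num.floor a \/ k%:Z = Num.ceil a.
Proof.
move=> /andP[k1 k2]; have [ka|ka] := leP (k%:R) a.
  left; apply/esym/floor_def; rewrite intrD mulr1z -pmulrn ka/=; lra.
by right; apply/esym/ceil_def; rewrite intrB mulr1z -pmulrn ltW ?ka ?andbT//; lra.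
Qed.

Lemma card_floor_or_ceil (a : R) (A : set nat) :
  A `<=` [set k : nat | k%:Z = Num.floor a \/ k%:Z = Num.ceil a] ->
  (A #<= `I_2)%card.
Proof.
move=> sub; pose g (i : nat) := (if i == 0%N then `|Num.floor a| else `|Num.ceil a|)%N.
apply: card_le_trans (card_image_le g `I_2); apply: subset_card_le.
by move=> k /sub[] h; [exists 0%N|exists 1%N] => //=; rewrite /g/= -h absz_nat.
Qed.

End LastTime.

Theorem theorem1p5 (R : realType) (d : measure_display) (T : measurableType d)
    (P : probability T R) (pick : nat -> T -> node)
    (Hpick : bst_process P pick)
    (bm bp : R) (Hb : bm < bp)
    (Hbm : 2 * expR bm * (1 - bm) = 1) (Hbp : 2 * expR bp * (1 - bp) = 1)
    (D : set R[i]^o) (W : T -> R[i]^o -> R[i]^o)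
    (HW : biggins_limit P pick bm bp D W) :
  exists K : T -> \bar R,
    [/\ measurable_fun [set: T] K,
        {ae P, forall w, K w \is a fin_num} &
        forall (w : T) (n : nat), (K w < n%:R%:E)%E ->
          let a := 2 * ln n%:R + chi1 W w - 2^-1 in
          (modes pick n w #<= `I_2)%card /\
          modes pick n w `<=`
            [set k : nat | k%:Z = Num.floor a \/ k%:Z = Num.ceil a]].
Proof.
have /andP[bm0 bp0] := roots_around0 Hb Hbm Hbp.
have D0 : D 0 by have := limit_interval HW bm0 bp0.
(* Any positive point of the domain would do to bound the second moment. *)
pose b : R := bp / 2; have b0 : 0 < b by rewrite divr_gt0.
have Db : D (real_complex _ b).
  by apply: (limit_interval HW); rewrite /b; lra.
have [N1 [mN1 PN1 HN1]] := ae_null_superset (limit_analytic HW).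
have [N2 [mN2 PN2 HN2]] := ae_null_superset (limit_uniform HW).
pose L := lim_sup_set (fun j => bad (R := R) (pick := pick) j.+2).
have mL : measurable L.
  apply: bigcapT_measurable => j; apply: bigcup_measurable => i _.
  exact: (bad_measurable Hpick).
have PL : P L = 0%E := bad_io_null Hpick.
pose N := N1 `|` N2 `|` L.
have mN : measurable N by apply: measurableU => //; exact: measurableU.
have PN : P N = 0%E.
  apply/negligibleP => //; apply: negligibleU; last exact/negligibleP.
  by apply: negligibleU; exact/negligibleP.
have chi_cvg w : ~ N w ->
    biggins_deriv n (bst_tree pick n w) @[n --> \oo] --> chi1 W w.
  move=> Nw; apply: (biggins_deriv_cvg (limit_open HW) D0).
    by apply: (HN1 _ _ _ D0) => h; apply: Nw; left; left.
  by apply: (HN2 w) => h; apply: Nw; left; right.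
(* A priori [chi1 W] is a derivative of an arbitrary family of functions; being
   a limit of functions of finite trees makes it measurable off [N]. *)
have mchi : measurable_fun (~` N) (chi1 W).
  apply: measurable_fun_cvg chi_cvg => n.
  by apply: measurable_funTS; exact: (tree_fun_measurable Hpick).
(* The exceptional event at time [n] is a countable union over the values [k] of
   the mode, each of which constrains [chi1 W] to an interval. *)
pose lo n k : R := k%:R - (2 * ln n%:R - 2^-1 + 1).
pose hi n k : R := k%:R - (2 * ln n%:R - 2^-1 - 1).
pose B n : set T := \bigcup_k ([set w | modes pick n w k] `&`
  (~` N `&` chi1 W @^-1` (~` `]lo n k, hi n k[))).
have mB n : measurable (B n).
  apply: bigcupT_measurable => k; apply: measurableI.
    exact: (tree_measurable Hpick n (fun t => forall j, (prof t j <= prof t k)%N)).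
  apply: mchi; first exact: measurableC.
  by apply: measurableC; exact: measurable_itv.
have inB n w : ~ N w -> ~ B n w -> forall k, modes pick n w k ->
    2 * ln n%:R + chi1 W w - 2^-1 - 1 < k%:R < 2 * ln n%:R + chi1 W w - 2^-1 + 1.
  move=> Nw Bw k mk; apply: contrapT => h; apply: Bw; exists k => //.
  split => //; split => //=; rewrite in_itv/= => /andP[h1 h2]; apply: h.
  by rewrite /lo /hi in h1 h2; apply/andP; split; lra.
have HB w : ~ N w -> exists K, forall n, (K <= n)%N -> ~ B n w.
  move=> Nw; have NN2 : ~ N2 w by move=> h; apply: Nw; left; right.
  have [C HC] := biggins_real_bounded Db (HN2 _ NN2).
  pose A := 2 * ((2 * expR b - 2) / b) ^+ 2.
  pose C' := 4 / b ^+ 2 * `|C|.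
  have [|||||K HK] := @modes_eventually R d T P pick Hpick (chi1 W w) A C' w.
  - by rewrite mulr_ge0// sqr_ge0.
  - by rewrite mulr_ge0// divr_ge0// sqr_ge0.
  - case: HC => M _ HM; exists M.+1 => // -[//|m] /= Mm.
    apply: le_trans (mean_sqr_le b0 (size_tree Hpick _ _)
      (HM m.+1 (ltnW Mm))) _.
    by rewrite lerD2l ler_wpM2l ?ler_norm// divr_ge0// sqr_ge0.
  - exact: chi_cvg.
  - by move=> h; apply: Nw; right.
  exists K => n Kn [k _ [mk [_ /= h]]]; apply: h.
  have /andP[h1 h2] := HK n k Kn mk.
  by rewrite in_itv/=; apply/andP; rewrite /lo /hi; split; lra.
have [K [mK fK HK]] := last_time_exists mN PN mB HB.
exists K; split => // w n Kn a.
have [Nw Bw] := HK w n Kn.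
have sub : modes pick n w `<=`
    [set k : nat | k%:Z = Num.floor a \/ k%:Z = Num.ceil a].
  by move=> k mk; apply: floor_or_ceil; exact: inB.
by split => //; exact: card_floor_or_ceil sub.
Qed.
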